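(* Let $\mu\in\{+,-\}$, $\ell\in[1,2h]$, $w\in\mathbb{Z}_{q+1}$, and let $d$ be an integer with $|d|\le 2h+1$. Put $\ell^+=\ell$, $\ell^-=2h+1-\ell$, and let $X_1=C_\ell^{\mu w+d}$, $X_2=C_{\ell^\mu}^w$ in $\mathcal{E}(\mathrm{SL}(2,q))$, $X=X_1\odot X_2$. Write $$X_{[\mu\mathbf e]}\cong n_0\mathbf 1\oplus m_0V\oplus\bigoplus_{\sigma=1}^{2h-1}n_\sigma W_\sigma\oplus\bigoplus_{\phi=1}^{2h}m_\phi X_\phi\oplus n'W'\oplus n''W''\oplus m'X'\oplus m''X''$$ as a representation of $\mathrm{SL}(2,q)$. Then: (1) if $d$ is even, $$n'=n''=1,\quad n_0=\delta_d^0,\quad n_\sigma=2\delta_{2\mid\sigma},\quad m'=m''=0,\quad m_0=2-\delta_d^0,\quad m_\phi=2\delta_{2\mid\phi}-\delta_{|d|}^\phi;$$ (2) if $d$ is odd, $$n_0=0,\quad n'=n''=0,\quad n_\sigma=2\delta_{2\nmid\sigma},\quad m_0=0,\quad m'=m''=1-\delta_{|d|}^{2h+1},\quad m_\phi=2\delta_{2\nmid\phi}-\delta_{|d|}^{\phi}.$$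
   Context: General setting. For a finite group $\Gamma$, $\mathcal{E}(\Gamma)$ is the category of finite-dimensional representations of the quantum double $D(\Gamma)$. Its objects are $\Gamma$-graded finite-dimensional complex vector spaces $U=\bigoplus_{x\in\Gamma}U_x$ with a left linear action $g\mapsto L^U_g$ of $\Gamma$ with $L^U_g(U_x)=U_{gxg^{-1}}$. Tensor product: $(U\odot V)_x=\bigoplus_{x_1x_2=x}U_{x_1}\otimes V_{x_2}$ with diagonal action. For $x\in\Gamma$ and an irreducible representation $\rho$ of the centralizer $\mathrm{Cen}(x)$ on $U(\rho)$, $U(x,\rho)$ is the simple object with $U(x,\rho)_y=U(\rho)$ for $y\in[x]$ (the conjugacy class of $x$), $0$ otherwise, with the induced action: fix left coset representatives $R_x$ of $\mathrm{Cen}(x)$; for $g\in\Gamma$, $a\in R_x$ write $ga=a'b$ with $a'\in R_x$, $b\in\mathrm{Cen}(x)$, and let $L_g:U(x,\rho)_{axa^{-1}}\to U(x,\rho)_{a'xa'^{-1}}$ be $\rho(b)$. For an object $X$ and central $z$, $X_{[z]}=X_z$ is a representation of $\Gamma$. Notation. $q=p^n\ge5$, $p$ an odd prime, $q=4h+1$; $\Gamma=\mathrm{SL}(2,q)$. For integers $a<b$, $[a,b]=\{a,a+1,\dots,b\}$. Signs $\pm$ are identified with $\pm1$; $\acute{+}=0$, $\acute{-}=1$. $\check e$ is a fixed generator of $\mathbb{F}_{q^2}^\times$, $\tilde e=\check e^{2h+1}$, $e=\tilde e^2$ (a generator of $\mathbb{F}_q^\times$), $f=\check e^{4h}$; $\zeta_m=\exp(2\pi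 i/m)$. $\mathbf e$ is the identity matrix, $\mathbf a=\mathrm{diag}(e,e^{-1})$, $\mathbf b_\varepsilon=\begin{pmatrix}1&e^{\acute\varepsilon}\\0&1\end{pmatrix}$, $\mathbf{c}=\begin{pmatrix}s_1&s_1'\tilde e^{-1}\\ s_1'\tilde e&s_1\end{pmatrix}$ with $s_1=\frac12(f+f^{-1})$, $s_1'=\frac12(f-f^{-1})$. $\mathrm{Cen}(\mathbf c^\ell)=\langle\mathbf c\rangle\cong\mathbb{Z}_{q+1}$ for $\ell\in[1,2h]$; $C_\ell^w=U(\mathbf c^\ell,w^* )$ with $w^*(\mathbf c^i)=\zeta_{q+1}^{iw}$ (upper indices are read modulo $q+1$). $\delta_x^y$ is the Kronecker delta; $\delta_P=1$ if the condition $P$ holds and $0$ otherwise. The irreducible representations of $\mathrm{SL}(2,q)$ are $\mathbf 1$, $V$, $W_\sigma$ ($\sigma\in[1,2h-1]$), $X_\phi$ ($\phi\in[1,2h]$), $W',W'',X',X''$, with characters, listed as values at $(\mu\mathbf e;\ \mathbf a^k;\ \mu\mathbf b_\varepsilon;\ \mathbf c^\ell)$ for $\mu,\varepsilon\in\{\pm\}$, $k\in[1,2h-1]$, $\ell\in[1,2h]$, and with $s_\pm=\frac12(1\pm\sqrt q)$: $\mathbf 1$: $(1;1;1;1)$; $V$: $(q;1;0;-1)$; $W_\sigma$: $((q+1)\mu^\sigma;\ \zeta_{q-1}^{\sigma k}+\zeta_{q-1}^{-\sigma k};\ \mu^\sigma;\ 0)$; $X_\phi$: $((q-1)\mu^\phi;\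 0;\ -\mu^\phi;\ -\zeta_{q+1}^{\phi\ell}-\zeta_{q+1}^{-\phi\ell})$; $W'$: $(2h+1;(-1)^k;s_\varepsilon;0)$; $W''$: $(2h+1;(-1)^k;s_{-\varepsilon};0)$; $X'$: $(2h\mu;0;-\mu s_\varepsilon;(-1)^{\ell+1})$; $X''$: $(2h\mu;0;-\mu s_{-\varepsilon};(-1)^{\ell+1})$. *)

(* Defs.v *)
(* The field of complex numbers is R[i], for R : realType.                    *)
From HB Require Import structures.
From mathcomp Require Import all_boot all_order all_algebra all_fingroup.
From mathcomp Require Import all_solvable all_field all_character.
From mathcomp Require Import complex.
From mathcomp Require Import reals trigo.

Set Implicit Arguments.
Unset Strict Implicit.
Unset Printing Implicit Defensive.

Import Order.TTheory GRing.Theory Num.Theory.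
Local Open Scope ring_scope.

(* An object of E(Gamma), given in a homogeneous basis (e_i) indexed by       *)
(* [obasis]: e_i lies in U_(odeg i), and L_g e_j = \sum_i oact g i j e_i.     *)
(* The last field says L_g(U_x) is contained in U_(g x g^-1); equality is     *)
(* then automatic, L_g being invertible.                                      *)
Record Eobj (C : fieldType) (gT : finGroupType) := MkEobj {
  obasis : finType;
  odeg : obasis -> gT;
  oact : gT -> obasis -> obasis -> C;
  oact1 : forall i j, oact 1%g i j = (i == j)%:R;
  oactM : forall g h i j,
    oact (g * h)%g i j = \sum_k oact g i k * oact h k j;
  oact_deg : forall g i j,
    oact g i j != 0 -> odeg i = (g * odeg j * g^-1)%g
}.

Section Category.
Variables (C : fieldType) (gT : finGroupType).

Section Tensor.
Variables U V : Eobj C gT.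

Let I := (obasis U * obasis V)%type.
Definition tens_deg (i : I) : gT := (odeg i.1 * odeg i.2)%g.
Definition tens_act (g : gT) (i j : I) : C :=
  oact g i.1 j.1 * oact g i.2 j.2.

Lemma tens_act1 i j : tens_act 1%g i j = (i == j)%:R.
Proof.
by case: i j => i1 i2 [j1 j2]; rewrite /tens_act !oact1 -natrM mulnb.
Qed.

Lemma tens_actM g h i j :
  tens_act (g * h)%g i j = \sum_k tens_act g i k * tens_act h k j.
Proof.
rewrite /tens_act !oactM big_distrlr /= pair_big /=.
by apply: eq_bigr => k _; rewrite mulrACA.
Qed.

Lemma tens_act_deg g i j :
  tens_act g i j != 0 -> tens_deg i = (g * tens_deg j * g^-1)%g.
Proof.
rewrite /tens_act mulf_eq0 negb_or => /andP[/oact_deg d1 /oact_deg d2].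
by rewrite /tens_deg d1 d2 !mulgA mulgKV.
Qed.

Definition Etens : Eobj C gT := MkEobj tens_act1 tens_actM tens_act_deg.

End Tensor.

Section Simple.
Variable x : gT.

(* The set R_x: one representative of each left coset of Cen(x).             *)
Definition lreps : {set gT} := [set repr A | A in lcosets 'C[x] [set: gT]].

Lemma lreps_mem (y : gT) : exists2 a, a \in lreps & (a^-1 * y)%g \in 'C[x]%g.
Proof.
exists (repr (y *: 'C[x])%g).
  by apply/imsetP; exists (y *: 'C[x])%g => //; apply/lcosetsP; exists y.
by rewrite -mem_lcoset lcoset_sym; apply: (mem_repr y); apply: lcoset_refl.
Qed.

Lemma lreps_inj (a b : gT) :
  a \in lreps -> b \in lreps -> (a^-1 * b)%g \in 'C[x]%g -> a = b.
Proof.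
case/imsetP=> _ /lcosetsP[a' _ ->] ->; case/imsetP=> _ /lcosetsP[b' _ ->] ->.
have rP u : repr (u *: 'C[x])%g \in (u *: 'C[x])%g.
  by apply: (mem_repr u); apply: lcoset_refl.
rewrite -mem_lcoset => abC; congr (repr _).
have /lcoset_eqP<- := rP a'; have /lcoset_eqP E := rP b'.
by rewrite -E; apply/esym/lcoset_eqP.
Qed.

Variables (d : nat) (rho : mx_representation C 'C[x] d).

Let I := ({a : gT | a \in lreps} * 'I_d)%type.

Definition simple_deg (i : I) : gT := (val i.1 * x * (val i.1)^-1)%g.

(* g a = a' b with b in Cen(x) amounts to a'^-1 g a being in Cen(x). *)
Definition simple_act (g : gT) (i j : I) : C :=
  let b := ((val i.1)^-1 * g * val j.1)%g in
  if b \in 'C[x]%g then rho b i.2 j.2 else 0.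

Lemma simple_act1 i j : simple_act 1%g i j = (i == j)%:R.
Proof.
case: i j => a i [b j]; rewrite /simple_act /= mulg1.
have [abC|abC] := ifP.
  have E : a = b by apply/val_inj/lreps_inj/abC; apply: valP.
  by rewrite E mulVg repr_mx1 mxE xpair_eqE eqxx.
case: eqP => // -[E _]; move: abC.
by rewrite E mulVg group1.
Qed.

Lemma simple_actM g h i j :
  simple_act (g * h)%g i j = \sum_k simple_act g i k * simple_act h k j.
Proof.
case: i j => a i [b j]; rewrite /simple_act /=.
have [c cR cC] := lreps_mem (h * val b)%g.
pose c0 : {a : gT | a \in lreps} := Sub c cR.
rewrite -(pair_bigA _ (fun k l =>
  simple_act g (a, i) (k, l) * simple_act h (k, l) (b, j))) /= /simple_act /=.
rewrite (bigD1 c0) //= [X in _ + X]big1 ?addr0; last first.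
  move=> k kc; apply: big1 => l _.
  have [_|] := ifP; last by rewrite mul0r.
  have [kC|] := ifP; last by rewrite mulr0.
  case/eqP: kc; apply/val_inj/lreps_inj; [exact: valP| exact: valP |].
  have -> : ((val k)^-1 * val c0 =
     ((val k)^-1 * h * val b) * (c^-1 * (h * val b))^-1)%g.
    by rewrite !invMg invgK /= !mulgA !mulgK.
  by rewrite groupM ?groupV.
have E : ((val a)^-1 * (g * h) * val b =
    ((val a)^-1 * g * c) * (c^-1 * (h * val b)))%g.
  by rewrite !mulgA mulgK.
rewrite E (groupMr _ cC); have [aC|aC] := ifP; last first.
  by rewrite big1 // => l _; rewrite mul0r.
rewrite -[(c^-1 * h * _)%g]mulgA cC repr_mxM // mxE.
by apply: eq_bigr.
Qed.

Lemma simple_act_deg g i j :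
  simple_act g i j != 0 -> simple_deg i = (g * simple_deg j * g^-1)%g.
Proof.
case: i j => a i [b j]; rewrite /simple_act /simple_deg /=.
have [/cent1P abC _|] := ifP; last by rewrite eqxx.
have E : (val a * (val a)^-1 * g * val b * x =
          val a * x * (val a)^-1 * g * val b)%g.
  by have := congr1 (mulg (val a)) abC; rewrite /commute !mulgA => <-.
by move: E; rewrite mulgV mul1g !mulgA => ->; rewrite !mulgK.
Qed.

(* The simple object U(x, rho). *)
Definition Esimple : Eobj C gT :=
  MkEobj simple_act1 simple_actM simple_act_deg.

End Simple.

Section Component.
Variables (X : Eobj C gT) (z : gT).
Hypothesis zZ : z \in 'Z([set: gT])%g.

Definition comp_mx (g : gT) : 'M[C]_#|[set i : obasis X | odeg i == z]| :=
  \matrix_(i, j) oact g (enum_val i) (enum_val j).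

Lemma comp_mx_repr : mx_repr [set: gT] comp_mx.
Proof.
split=> [|g h _ _].
  by apply/matrixP=> i j; rewrite !mxE oact1 (inj_eq enum_val_inj).
apply/matrixP=> i j; rewrite !mxE oactM.
rewrite (bigID (mem [set k : obasis X | odeg k == z])) /= [X in _ + X]big1 ?addr0.
  by rewrite big_enum_val; apply: eq_bigr => k _; rewrite !mxE.
move=> k kz; have [->|ne0] := eqVneq (oact h k (enum_val j)) 0.
  by rewrite mulr0.
case/negP: kz; have := enum_valP j; rewrite !inE => /eqP dj.
rewrite (oact_deg ne0) dj; case/centerP: zZ => _ /(_ h (in_setT h)) zh.
by rewrite -zh mulgK.
Qed.

(* X_[z] for a central z. *)
Definition Ecomp : representation C [set: gT] :=
  Representation (MxRepresentation comp_mx_repr).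

End Component.
End Category.

Section SL2.
Variable F : finFieldType.

Record SL2 := MkSL2 { SL2val :> 'M[F]_2; _ : \det SL2val == 1 }.
HB.instance Definition _ := [isSub for SL2val].
HB.instance Definition _ := [Finite of SL2 by <:].

Lemma SL2_oneP : \det (1%:M : 'M[F]_2) == 1.
Proof. by rewrite det1. Qed.
Lemma SL2_mulP (A B : SL2) : \det (SL2val A *m SL2val B) == 1.
Proof. by rewrite det_mulmx (eqP (valP A)) (eqP (valP B)) mulr1. Qed.
Lemma SL2_invP (A : SL2) : \det (invmx (SL2val A)) == 1.
Proof. by rewrite det_inv (eqP (valP A)) invr1. Qed.

Definition SL2_one := MkSL2 SL2_oneP.
Definition SL2_mul A B := MkSL2 (SL2_mulP A B).
Definition SL2_inv A := MkSL2 (SL2_invP A).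

Lemma SL2_mulA : associative SL2_mul.
Proof. by move=> A B D; apply/val_inj; rewrite /= mulmxA. Qed.
Lemma SL2_mul1 : left_id SL2_one SL2_mul.
Proof. by move=> A; apply/val_inj; rewrite /= mul1mx. Qed.
Lemma SL2_mulV : left_inverse SL2_one SL2_inv SL2_mul.
Proof.
move=> A; apply/val_inj; rewrite /= mulVmx //.
by rewrite unitmxE (eqP (valP A)) unitr1.
Qed.

HB.instance Definition _ :=
  Finite_isGroup.Build SL2 SL2_mulA SL2_mul1 SL2_mulV.

(* M as an element of SL(2, F); only used for matrices M of determinant 1.    *)
Definition to_SL2 (M : 'M[F]_2) : SL2 := insubd SL2_one M.

Definition mx2 (a b c d : F) : 'M[F]_2 :=
  \matrix_(i, j) if i == 0 then if j == 0 then a else b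
                 else if j == 0 then c else d.

(* A sign is a boolean, false for + and true for -: its acute is its value as *)
(* a natural number, and mu itself is (-1) ^+ mu.                             *)
Definition sl2_e (mu : bool) : SL2 := to_SL2 ((-1) ^+ mu)%:M.

Lemma sl2_eE mu : val (sl2_e mu) = ((-1) ^+ mu)%:M.
Proof.
by rewrite val_insubd det_scalar -exprM mulnC exprM sqrrN !expr1n eqxx.
Qed.

Lemma sl2_e_central mu : sl2_e mu \in 'Z([set: SL2])%g.
Proof.
apply/centerP; split=> [|A _]; first exact: in_setT.
by apply/val_inj; rewrite /= sl2_eE scalar_mxC.
Qed.

Variables (K : finFieldType) (iota : {rmorphism F -> K}).

(* The element of F identified with y : K, for y in the image of F.           *)
Definition descend (y : K) : F := odflt 0 [pick x | iota x == y].

Variables (h : nat) (ec : K).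

Definition gen_et : K := ec ^+ (2 * h + 1).
Definition gen_e : F := descend (gen_et ^+ 2).
Definition gen_f : K := ec ^+ (4 * h).

Definition sl2_a : SL2 := to_SL2 (mx2 gen_e 0 0 gen_e^-1).
Definition sl2_b (eps : bool) : SL2 := to_SL2 (mx2 1 (gen_e ^+ eps) 0 1).
(* gen_f^q = gen_f^-1 and gen_et^q = - gen_et, so the three entries below are *)
(* fixed by the q-Frobenius and hence lie in the image of F.                  *)
Definition sl2_c : SL2 :=
  let s1 := (gen_f + gen_f^-1) / 2 in
  let s1' := (gen_f - gen_f^-1) / 2 in
  to_SL2 (mx2 (descend s1) (descend (s1' * gen_et^-1))
              (descend (s1' * gen_et)) (descend s1)).

End SL2.

Section Table.
Variable R : realType.
Local Open Scope complex_scope.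

(* exp(2 pi i / m) *)
Definition zeta (m : nat) : R[i] :=
  cos (2 * pi / m%:R) +i* sin (2 * pi / m%:R).

Variables (F K : finFieldType) (iota : {rmorphism F -> K}).
Variables (h : nat) (ec : K).
Let q := (4 * h + 1)%N.
Let a := sl2_a iota h ec.
Let b := sl2_b iota h ec.
Let c := sl2_c iota h ec.

Definition SL2rep := representation R[i] [set: SL2 F].

(* rho is w^*.  It is pinned down as soon as Cen(x) = <c>, which holds for    *)
(* x = c^l with 1 <= l <= 2h; C_l^w is then Esimple rho.  The upper index w   *)
(* is an integer standing for its class modulo q + 1.                         *)
Definition wstar (x : SL2 F) (w : int) (rho : mx_representation R[i] 'C[x] 1) :=
  forall i : nat, rho (c ^+ i)%g = (zeta q.+1 ^ (i%:Z * w))%:M.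

(* rho is irreducible, with the given character values at mu e, a^k,          *)
(* mu b_eps and c^l.                                                          *)
Definition table_row (rho : SL2rep) (xe : bool -> R[i]) (xa : nat -> R[i])
    (xb : bool -> bool -> R[i]) (xc : nat -> R[i]) : Prop :=
  mx_irreducible rho /\
  [/\ forall mu, \tr (rho (sl2_e F mu)) = xe mu,
      forall k, (1 <= k <= 2 * h - 1)%N -> \tr (rho (a ^+ k)%g) = xa k,
      forall mu eps, \tr (rho (sl2_e F mu * b eps)%g) = xb mu eps &
      forall l, (1 <= l <= 2 * h)%N -> \tr (rho (c ^+ l)%g) = xc l].

(* s_+ = s_pm false and s_- = s_pm true *)
Definition s_pm (eps : bool) : R[i] :=
  (1 + (-1) ^+ eps * (Num.sqrt (q%:R : R))%:C) / 2.

Record SL2_irreps := {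
  irr1 : SL2rep;
  irrV : SL2rep;
  irrW : nat -> SL2rep;
  irrX : nat -> SL2rep;
  irrW' : SL2rep;
  irrW'' : SL2rep;
  irrX' : SL2rep;
  irrX'' : SL2rep
}.

Definition char_table (T : SL2_irreps) : Prop :=
  table_row (irr1 T)
    (fun=> 1) (fun=> 1) (fun _ _ => 1) (fun=> 1) /\
  table_row (irrV T)
    (fun=> q%:R) (fun=> 1) (fun _ _ => 0) (fun=> -1) /\
  (forall s, (1 <= s <= 2 * h - 1)%N -> table_row (irrW T s)
    (fun mu => q.+1%:R * ((-1) ^+ mu) ^+ s)
    (fun k => zeta q.-1 ^+ (s * k) + zeta q.-1 ^- (s * k))
    (fun mu _ => ((-1) ^+ mu) ^+ s)
    (fun=> 0)) /\
  (forall p, (1 <= p <= 2 * h)%N -> table_row (irrX T p)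
    (fun mu => q.-1%:R * ((-1) ^+ mu) ^+ p)
    (fun=> 0)
    (fun mu _ => - ((-1) ^+ mu) ^+ p)
    (fun l => - zeta q.+1 ^+ (p * l) - zeta q.+1 ^- (p * l))) /\
  table_row (irrW' T)
    (fun=> (2 * h + 1)%:R) (fun k => (-1) ^+ k)
    (fun _ eps => s_pm eps) (fun=> 0) /\
  table_row (irrW'' T)
    (fun=> (2 * h + 1)%:R) (fun k => (-1) ^+ k)
    (fun _ eps => s_pm (~~ eps)) (fun=> 0) /\
  table_row (irrX' T)
    (fun mu => (2 * h)%:R * (-1) ^+ mu) (fun=> 0)
    (fun mu eps => - (-1) ^+ mu * s_pm eps) (fun l => (-1) ^+ l.+1) /\
  table_row (irrX'' T)
    (fun mu => (2 * h)%:R * (-1) ^+ mu) (fun=> 0)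
    (fun mu eps => - (-1) ^+ mu * s_pm (~~ eps)) (fun l => (-1) ^+ l.+1).

(* n_ and m_ only matter on [1, 2h - 1] and [1, 2h] respectively.            *)
Record mults := {
  n0 : nat; m0 : nat;
  n_ : nat -> nat; m_ : nat -> nat;
  n' : nat; n'' : nat; m' : nat; m'' : nat
}.

Definition irr_sum (T : SL2_irreps) (M : mults) : SL2rep :=
  let plus := @dadd_grepr R[i] (SL2 F) [set: SL2 F]%G in
  plus (muln_grepr (irr1 T) (n0 M))
  (plus (muln_grepr (irrV T) (m0 M))
  (plus (\big[plus/grepr0]_(1 <= s < 2 * h) muln_grepr (irrW T s) (n_ M s))
  (plus (\big[plus/grepr0]_(1 <= p < (2 * h).+1) muln_grepr (irrX T p) (m_ M p))
  (plus (muln_grepr (irrW' T) (n' M))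
  (plus (muln_grepr (irrW'' T) (n'' M))
  (plus (muln_grepr (irrX' T) (m' M))
        (muln_grepr (irrX'' T) (m'' M)))))))).

End Table.

(* Valued in int because it gets subtracted.                                  *)
Definition delta (P : bool) : int := (P : nat)%:Z.

(* Main.v *)
Require Import Defs.
From HB Require Import structures.
From mathcomp Require Import all_boot all_order all_algebra all_fingroup.
From mathcomp Require Import all_solvable all_field all_character.
From mathcomp Require Import complex.
From mathcomp Require Import reals trigo.
From mathcomp Require Import ring zify.

Set Implicit Arguments.
Unset Strict Implicit.
Unset Printing Implicit Defensive.

Import Order.TTheory GRing.Theory Num.Theory.
Local Open Scope ring_scope.

(* A homogeneous pair of degree mu e is determined up to Cen(c^l) = <c> by    *)
(* its first component, so X_[mu e] is induced from a linear character of     *)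
(* <c>.  When mu = + the second factor is inverted, c being conjugate to its  *)
(* inverse because -1 is a square in F_q; in both cases the linear character  *)
(* is d^*.  By Frobenius reciprocity the multiplicity of an irreducible U is  *)
(* the average over <c> of its character against d^*, a sum of roots of unity *)
(* given by the character table.  These multiplicities already account for    *)
(* the whole degree q (q - 1), so no other irreducible occurs.                *)

(** * A character pairing for representations *)

(** Write m = q + 1 and z = [zeta R m]. Once s is chosen with s x1 s^-1 x2 = mu e ([conj_pair]), the
    vectors of degree mu e are organised by the cosets of Cen(x1): the left factor determines the
    right one up to its centralizer ([deg_pairE]). Pairing with the component therefore reduces to a
    sum over Cen(x1) ([rdot_Ecomp_tens]). By [cent1_sl2_c] this centralizer is <c>, cyclic of order
    m, and the weights mu w + d and - mu w add up to d, so each multiplicity is (1/m) sum_i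
    chi(c^-i) z^(i d) ([rdot_Xmu]).

    On <c> each row of the table is a term supported on the centre plus kap (z^(J i) + z^(- J i)).
    The first term contributes N exactly when d + S is even, the second contributes kap for each of
    the congruences d = J and d = - J modulo m ([rdot_Xmu_row]). For |d| <= 2h + 1 these numbers are
    the closed forms [expected] ([row_expected]).

    The degrees weighted by [expected] add up to q (q - 1), the degree of the component
    ([degree_expected], [degree_Xmu]), so [rsim_orthogonal_sum] yields an isomorphism. Conversely,
    the rows are irreducible and pairwise non-isomorphic ([table_irr], [table_inj]), so pairing with
    them reads the multiplicities off any decomposition and forces them to be the expected ones. *)

Section RepresentationPairing.
Variables (C : numClosedFieldType) (gT : finGroupType) (G : {group gT}).
Local Notation repr := (representation C G).
Implicit Types A B U V : repr.

(** The usual inner product of characters; evaluating A at g^-1 replaces complex conjugation, so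
    only traces are involved. *)
Definition rdot A B : C :=
  #|G|%:R^-1 * \sum_(g in G) \tr (A g^-1%g) * \tr (B g).

Lemma cardG_neq0 : #|G|%:R != 0 :> C.
Proof. by rewrite pnatr_eq0 -lt0n cardG_gt0. Qed.

Lemma rdot_rsim A A' B B' :
  mx_rsim A A' -> mx_rsim B B' -> rdot A B = rdot A' B'.
Proof.
move=> sA sB; congr (_ * _); apply: eq_bigr => g Gg.
by rewrite (mxtrace_rsim sA) ?groupV // (mxtrace_rsim sB).
Qed.

Lemma rdotDr A B B' : rdot A (dadd_grepr B B') = rdot A B + rdot A B'.
Proof.
rewrite -mulrDr -big_split; congr (_ * _); apply: eq_bigr => g _.
by rewrite /= mxtrace_block mulrDr.
Qed.

Lemma rdot0r A : rdot A grepr0 = 0.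
Proof.
by rewrite /rdot big1 ?mulr0 // => g _; rewrite [X in _ * X]big_ord0 mulr0.
Qed.

Lemma rsim_dadd A A' B B' : mx_rsim A A' -> mx_rsim B B' ->
  mx_rsim (dadd_grepr A B) (dadd_grepr A' B').
Proof.
case=> f dA; case: A' f dA => n A' f /= dA; subst n => fA hA.
case=> g dB; case: B' g dB => n B' g /= dB; subst n => gB hB.
exists (block_mx f 0 0 g) => //= [|x Gx]; last first.
  by rewrite !mulmx_block !mul0mx !mulmx0 !addr0 !add0r hA ?hB.
rewrite row_free_unit unitmxE det_ublock unitrM -!unitmxE -!row_free_unit.
by rewrite fA gB.
Qed.

Section Intertwiner.
Variables A B : repr.

Definition intertwiner (f : 'M[C]_(rdegree A, rdegree B)) :=
  forall g, g \in G -> A g *m f = f *m B g.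

Definition average (Z : 'M[C]_(rdegree A, rdegree B)) :=
  \sum_(g in G) A g^-1%g *m Z *m B g.

Lemma average_intertwiner Z : intertwiner (average Z).
Proof.
move=> g Gg; rewrite /average mulmx_sumr mulmx_suml.
rewrite (reindex_acts 'R _ Gg) ?astabsR //=; apply: eq_bigr => x Gx.
rewrite invMg !repr_mxM ?groupV // !mulmxA -repr_mxM ?groupV //.
by rewrite mulgV repr_mx1 mul1mx.
Qed.

(** The map Z |-> A(g^-1) Z B(g) has trace tr A(g^-1) tr B(g), so the pairing is the normalised
    trace of the averaging operator, computed on matrix units. A nonzero pairing thus produces a
    nonzero intertwiner. *)
Lemma rdot_average :
  rdot A B = #|G|%:R^-1 * \sum_i \sum_j average (delta_mx i j) i j.
Proof.
congr (_ * _); under [RHS]eq_bigr => i _ do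
  (under eq_bigr => j _ do rewrite /average summxE; rewrite exchange_big /=).
rewrite [RHS]exchange_big /=; apply: eq_bigr => g _.
rewrite /mxtrace big_distrlr /=; apply: eq_bigr => i _; apply: eq_bigr => j _.
rewrite mxE (bigD1 j) //= big1 ?addr0 => [|k kj].
  rewrite mxE (bigD1 i) //= big1 ?addr0 => [|k ki].
    by rewrite !mxE !eqxx mulr1.
  by rewrite !mxE (negPf ki) mulr0.
by rewrite mxE big1 ?mul0r // => m _; rewrite !mxE (negPf kj) andbF mulr0.
Qed.

Lemma rdot_neq0_intertwiner :
  rdot A B != 0 -> exists2 f, intertwiner f & f != 0.
Proof.
move=> nz; have [/existsP[i /existsP[j fn0]]|none] :=
  boolP [exists i, exists j, average (delta_mx i j) i j != 0].
  exists (average (delta_mx i j)); first exact: average_intertwiner.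
  by apply: contraNneq fn0 => ->; rewrite mxE.
case/eqP: nz; rewrite rdot_average big1 ?mulr0 // => i _.
rewrite big1 // => j _; apply/eqP; apply: contraNT none => n0.
by apply/existsP; exists i; apply/existsP; exists j.
Qed.

Variable f : 'M[C]_(rdegree A, rdegree B).
Hypotheses (homf : intertwiner f) (f0 : f != 0).

Lemma intertwiner_row_free : mx_irreducible A -> row_free f.
Proof.
case/mx_irrP=> _ irr; rewrite -kermx_eq0; apply: contraNT f0 => /irr fullK.
rewrite -[f]mul1mx; apply/eqP/sub_kermxP; rewrite submx_full //; apply: fullK.
apply/mxmoduleP=> g Gg; apply/sub_kermxP.
by rewrite -mulmxA homf // mulmxA mulmx_ker mul0mx.
Qed.

Lemma intertwiner_mxmodule : mxmodule B <<f>>%MS.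
Proof.
rewrite (eqmx_module _ (genmxE f)); apply/mxmoduleP=> g Gg.
by rewrite -homf // submxMl.
Qed.

Lemma intertwiner_submod_rsim :
  row_free f -> mx_rsim A (submod_repr intertwiner_mxmodule).
Proof.
move=> freef; have sf : (f <= <<f>>)%MS by rewrite genmxE.
exists (in_submod _ f) => [||g Gg].
- by rewrite genmxE; apply/esym/eqP.
- by rewrite /row_free mxrank_in_submod.
by rewrite -in_submodJ // -homf // [in RHS]in_submodE -mulmxA -in_submodE.
Qed.

(** Schur's lemma: the kernel of f is a proper submodule of A, and its image is a nonzero submodule
    of B. *)
Lemma intertwiner_rsim :
  mx_irreducible A -> mx_irreducible B -> mx_rsim A B.
Proof.
move=> irrA irrB; apply: mx_rsim_trans (_ : mx_rsim A _) _.
  exact: intertwiner_submod_rsim (intertwiner_row_free irrA).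
apply: rsim_submod1; apply/eqmxP; rewrite submx1 sub1mx.
case/mx_irrP: irrB => _; apply; first exact: intertwiner_mxmodule.
by apply: contraNneq f0 => fz; rewrite -submx0 -(genmxE f) fz submx0.
Qed.

End Intertwiner.

Lemma rdot_nrsim A B : mx_irreducible A -> mx_irreducible B ->
  ~ mx_rsim A B -> rdot A B = 0.
Proof.
move=> irrA irrB nAB; apply/eqP; apply: contra_notT nAB.
by case/rdot_neq0_intertwiner=> f homf f0; apply: intertwiner_rsim homf f0 _ _.
Qed.

(** By Schur the average of Z is scalar, and its trace #|G| tr Z fixes the scalar. Only the diagonal
    matrix units contribute, each by #|G| / [rdegree A]. *)
Lemma rdot_irr A : mx_irreducible A -> rdot A A = 1.
Proof.
move=> irrA; have n_gt0 : (rdegree A > 0)%N by case/mx_irrP: irrA.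
have n0 : (rdegree A)%:R != 0 :> C by rewrite pnatr_eq0 -lt0n.
have avg Z : average (A := A) (B := A) Z =
    (#|G|%:R * \tr Z / (rdegree A)%:R)%:M.
  have /is_scalar_mxP[a aE] : is_scalar_mx (average Z).
    apply: (mx_abs_irr_cent_scalar (group_closure_closed_field irrA)).
    by apply/centgmxP=> g Gg; rewrite average_intertwiner.
  suff <- : \tr (average (A := A) (B := A) Z) = #|G|%:R * \tr Z.
    by rewrite aE mxtrace_scalar -(mulr_natr a) mulfK.
  rewrite raddf_sum /= (eq_bigr (fun=> \tr Z)) => [|g Gg].
    by rewrite sumr_const mulr_natl.
  by rewrite mxtrace_mulC mulmxA -repr_mxM ?groupV // mulgV repr_mx1 mul1mx.
rewrite rdot_average; under eq_bigr => i _.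
  rewrite (bigD1 i) //= big1 ?addr0 => [|j ji]; last first.
    by rewrite avg mxE eq_sym (negPf ji) mulr0n.
  rewrite avg mxE eqxx mulr1n /mxtrace (bigD1 i) //= mxE !eqxx big1 => [|j ji].
    by rewrite addr0 mulr1; over.
  by rewrite mxE (negPf ji).
rewrite sumr_const card_ord -[_ *+ rdegree A]mulr_natr mulfVK // mulVf //; exact: cardG_neq0.
Qed.

Lemma submod_complement A (W : 'M_(rdegree A)) (modW : mxmodule A W) :
  exists A', mx_rsim A (dadd_grepr (Representation (submod_repr modW)) A').
Proof.
have pG : ([pchar C]^'.-group G)%g.
  by apply/pgroupP=> p _ _; rewrite inE /= pchar_num.
have [W' modW' addW dxW] := mx_Maschke_pchar A pG modW (submx1 W).
exists (Representation (submod_repr modW')).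
apply: mx_rsim_trans (mx_rsim_sym (rsim_submod1 (mxmodule1 A) _)) _ => //.
by apply: mx_rsim_dadd addW dxW _ _; apply: mx_rsim_refl.
Qed.

Lemma irr_summand A : (rdegree A > 0)%N ->
  exists U B, mx_irreducible U /\ mx_rsim A (dadd_grepr U B).
Proof.
move=> n_gt0; have nz1 : (1%:M : 'M[C]_(rdegree A)) != 0.
  by rewrite -mxrank_eq0 mxrank1 -lt0n.
have [W simW _] := dec_mxsimple_exists (mxmodule1 A) nz1.
have modW := mxsimple_module simW; have [B AB] := submod_complement modW.
by exists (Representation (submod_repr modW)), B; split=> //; apply/submod_mx_irr.
Qed.

Lemma rdot_neq0_summand U A : mx_irreducible U -> rdot U A != 0 ->
  exists B, mx_rsim A (dadd_grepr U B).
Proof.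
move=> irrU /rdot_neq0_intertwiner[f homf f0].
have [B AB] := submod_complement (intertwiner_mxmodule homf).
exists B; apply: mx_rsim_trans AB _.
apply: rsim_dadd (mx_rsim_refl B); apply: mx_rsim_sym.
exact/intertwiner_submod_rsim/intertwiner_row_free.
Qed.

(** Irreducible summands are peeled off A, each contributing 0 or 1. Values in nat ensure that
    pairings cannot cancel when summands are added. *)
Lemma rdot_natr U A : mx_irreducible U -> exists k : nat, rdot U A = k%:R.
Proof.
move=> irrU; have [n] := ubnP (rdegree A); elim: n A => // n IHn A leA.
have [A0|A_gt0] := posnP (rdegree A).
  exists 0; rewrite /rdot big1 ?mulr0 // => g _.
  by rewrite [X in _ * X]big1 ?mulr0 // => i; have := ltn_ord i; rewrite {2}A0.
have [V [B [irrV AVB]]] := irr_summand A_gt0.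
have [|k kE] := IHn B.
  have := mxrank_rsim AVB; case/mx_irrP: irrV => /= V_gt0 _ E.
  by rewrite ltnS in leA; apply: leq_trans leA; rewrite E -add1n leq_add2r.
rewrite (rdot_rsim (mx_rsim_refl _) AVB) rdotDr kE.
have [->|/(rdot_neq0_intertwiner)[f homf f0]] := eqVneq (rdot U V) 0.
  by exists k; rewrite add0r.
have UV := intertwiner_rsim homf f0 irrU irrV.
exists k.+1; rewrite -(rdot_rsim (mx_rsim_refl U) UV) rdot_irr //.
by rewrite -natr1 addrC.
Qed.

(* Splitting off common irreducible summands, it is enough to compare A and  *)
(* B on the constituents of B, provided the degrees agree.                    *)
Lemma rsim_rdot_degree A B : rdegree A = rdegree B ->
  (forall U, mx_irreducible U -> rdot U B != 0 -> rdot U A = rdot U B) ->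
  mx_rsim A B.
Proof.
have [n] := ubnP (rdegree B); elim: n A B => // n IHn A B leB dAB eqAB.
have [B0|B_gt0] := posnP (rdegree B).
  exists 0 => [||g _]; rewrite ?mulmx0 ?mul0mx //.
  by rewrite /row_free mxrank0 dAB B0.
have [U [B' [irrU BUB']]] := irr_summand B_gt0.
have [k kE] := rdot_natr B' irrU.
have UB : rdot U B = k.+1%:R.
  by rewrite (rdot_rsim (mx_rsim_refl _) BUB') rdotDr rdot_irr // kE -natr1 addrC.
have UB0 : rdot U B != 0 by rewrite UB pnatr_eq0.
have [|A' AUA'] := rdot_neq0_summand (A := A) irrU; first by rewrite eqAB.
apply: (mx_rsim_trans AUA'); apply: (mx_rsim_trans _ (mx_rsim_sym BUB')).
apply: (rsim_dadd (mx_rsim_refl U)); have /= EA := mxrank_rsim AUA'.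
have /= EB := mxrank_rsim BUB'; apply: IHn => [||V irrV VB'].
- case/mx_irrP: irrU => U_gt0 _; rewrite ltnS in leB; apply: leq_trans leB.
  by rewrite EB -add1n leq_add2r.
- by apply/eqP; rewrite -(eqn_add2l (rdegree U)) -EA -EB dAB.
have eqV (X X' : repr) : mx_rsim X (dadd_grepr U X') -> rdot V X = rdot V U + rdot V X'.
  by move=> s; rewrite (rdot_rsim (mx_rsim_refl _) s) rdotDr.
apply: (addrI (rdot V U)); rewrite -(eqV _ _ AUA') -(eqV _ _ BUB').
apply: (eqAB V irrV); rewrite (eqV _ _ BUB').
(* A constituent V of B' is also one of B: the pairings with U and B' are natural numbers, so their
   sum is nonzero as soon as the second is. *)
have [i ->] := rdot_natr U irrV; have [j jE] := rdot_natr B' irrV.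
move: VB'; rewrite jE -natrD !pnatr_eq0 addn_eq0.
by case: j {jE} => // j _; rewrite andbF.
Qed.

End RepresentationPairing.

(** * Tensor products of two simple objects *)

Section TensorOfSimples.
Variables (C : numClosedFieldType) (gT : finGroupType).

(** Extension by zero off the centralizer, as in the formula for an induced character. *)
Definition ctrace (x : gT) d (rho : mx_representation C 'C[x] d) (y : gT) : C :=
  if y \in 'C[x]%g then \tr (rho y) else 0.

Lemma ctraceJ (x : gT) d (rho : mx_representation C 'C[x] d) (y b : gT) :
  b \in 'C[x]%g -> ctrace rho (y ^ b) = ctrace rho y.
Proof.
move=> bC; rewrite /ctrace groupJr //; case: ifP => // yC.
by rewrite !repr_mxM ?groupM ?groupV // mxtrace_mulC repr_mxK.
Qed.

Variables x1 x2 s z : gT.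
Hypotheses (zZ : z \in 'Z([set: gT])%g) (sz : (s * x1 * s^-1 * x2)%g = z).
Variables (d1 d2 : nat).
Variables (rho1 : mx_representation C 'C[x1] d1).
Variables (rho2 : mx_representation C 'C[x2] d2).

Let X := Etens (Esimple rho1) (Esimple rho2).
Let Xz := Ecomp X zZ.

(** With u = a s^-1 and z central, a x1 a^-1 = z u x2^-1 u^-1, so the product has degree z exactly
    when u and b conjugate x2 to the same element. *)
Lemma deg_pairE (a b : gT) :
  (a * x1 * a^-1 * (b * x2 * b^-1) == z)%g = ((b^-1 * (a * s^-1))%g \in 'C[x2]%g).
Proof.
have zc y : commute z y by case/centerP: zZ => _ /(_ y (in_setT y)).
have x1E : x1 = (s^-1 * (z * x2^-1) * s)%g.
  by rewrite -sz !mulgA mulgK mulgKV mulVg mul1g.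
have -> : (a * x1 * a^-1 = z * (a * s^-1 * x2^-1 * (a * s^-1)^-1))%g.
  by rewrite x1E invMg invgK !mulgA -(zc (a * s^-1)%g) !mulgA.
move: (a * s^-1)%g => u; rewrite -mulgA -{2}(mulg1 z) (inj_eq (mulgI z)).
rewrite (sameP cent1P eqP) /commute; apply/eqP/eqP=> [E|E].
  apply: (mulgI b); rewrite !mulgA mulgV mul1g.
  have E' : (b * x2 * b^-1 = u * x2 * u^-1)%g.
    have := congr1 (fun y => u * x2 * u^-1 * y)%g E.
    by rewrite /= mulg1 !mulgA mulgKV mulgK mulgV mul1g.
  by have := congr1 (fun y => y * u)%g E'; rewrite /= mulgKV.
have E' : (b * x2 * b^-1 = u * x2 * u^-1)%g.
  have := congr1 (fun y => b * y * u^-1)%g E.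
  by rewrite /= !mulgA mulgV mul1g mulgK => <-.
by rewrite E' !mulgA !mulgKV mulgV.
Qed.

Lemma mxtrace_Ecomp_tens g : \tr (Xz g) =
  \sum_(a in lreps x1) ctrace rho1 (g ^ a) * ctrace rho2 (g ^ (a * s^-1)).
Proof.
have trE : \tr (Xz g) = \sum_(i : obasis X | odeg i == z) oact g i i.
  rewrite [RHS](eq_bigl [in [set i : obasis X | odeg i == z]]) => [|i].
    by rewrite big_enum_val; apply: eq_bigr => i _; rewrite mxE.
  by rewrite inE.
rewrite {}trE (eq_bigl (fun i : obasis X => predT i.1 && (odeg i == z))) //.
rewrite -(pair_big_dep predT (fun i j => @odeg _ _ X (i, j) == z)
  (fun i j => @oact _ _ X g (i, j) (i, j))) /=.
rewrite /tens_act /tens_deg /= /simple_deg /=.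
rewrite -(pair_bigA _ (fun (a : {a | a \in lreps x1}) (k : 'I_d1) => \sum_(j : {a : gT | a \in lreps x2} * 'I_d2 |
   (val a * x1 * (val a)^-1 * (val j.1 * x2 * (val j.1)^-1) == z)%g)
     simple_act rho1 g (a, k) (a, k) * simple_act rho2 g j j)) /=.
rewrite [RHS]big_sub /=; apply: eq_bigr => a _.
(* The representative c of the coset a s^-1 Cen(x2) is the only one that completes a to a pair of
   degree z. *)
have [c cR cC] := lreps_mem x2 (val a * s^-1)%g.
pose c0 : {c : gT | c \in lreps x2} := Sub c cR.
under eq_bigr => k _.
  rewrite (eq_bigl (fun j : {a : gT | a \in lreps x2} * 'I_d2 => (j.1 == c0) && predT j.2)) => [|j]; last first.
    rewrite deg_pairE andbT; apply/idP/eqP => [jC|->//].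
    apply/val_inj/(@lreps_inj _ x2) => //; first exact: valP.
    have -> : ((val j.1)^-1 * c = ((val j.1)^-1 * (val a * s^-1)) *
        (c^-1 * (val a * s^-1))^-1)%g.
      by rewrite !invMg !invgK !mulgA mulgKV mulgK.
    by rewrite groupM ?groupV.
  rewrite -(pair_big (pred1 c0) predT (fun b m =>
     simple_act rho1 g (a, k) (a, k) * simple_act rho2 g (b, m) (b, m))) /=.
  rewrite big_pred1_eq -mulr_sumr; over.
rewrite -mulr_suml; congr (_ * _).
  rewrite /ctrace conjgE mulgA /simple_act /=; case: ifP => // _.
  by rewrite big1.
(* Replacing c by a s^-1 conjugates the argument by an element of Cen(x2), which leaves the trace
   unchanged. *)
rewrite -(ctraceJ rho2 _ (groupVr cC)) -conjgM invMg invgK mulKVg.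
rewrite /ctrace conjgE mulgA /simple_act /=; case: ifP => // _.
by rewrite big1.
Qed.

Lemma card_lreps x : (#|@lreps gT x| * #|'C[x]%g| = #|gT|)%N.
Proof.
rewrite -cardsT -(Lagrange (subsetT 'C[x]%g)) mulnC; congr (_ * _)%N.
rewrite -[RHS]card_lcosets /lreps card_in_imset // => A B.
case/lcosetsP=> a _ -> /lcosetsP[b _ ->] E.
have rP u : repr (u *: 'C[x])%g \in (u *: 'C[x])%g.
  by apply: (mem_repr u); apply: lcoset_refl.
by have /lcoset_eqP <- := rP a; have /lcoset_eqP <- := rP b; rewrite E.
Qed.

Lemma degree_Ecomp_tens : rdegree Xz = (#|lreps x1| * (d1 * d2))%N.
Proof.
apply/eqP; rewrite -(eqr_nat C) -mxtrace1 -(repr_mx1 Xz) mxtrace_Ecomp_tens.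
rewrite (eq_bigr (fun=> (d1 * d2)%:R)) => [|a _]; last first.
  by rewrite !conj1g /ctrace !group1 !repr_mx1 !mxtrace1 natrM.
by rewrite sumr_const -mulrnA mulnC.
Qed.

(* Frobenius reciprocity: Xz is induced from the centralizer of x1. *)
Lemma rdot_Ecomp_tens U : rdot U Xz = #|'C[x1]%g|%:R^-1 *
  \sum_(k in 'C[x1]%g) \tr (U k^-1%g) * (\tr (rho1 k) * ctrace rho2 (k ^ s^-1)).
Proof.
rewrite /rdot; under eq_bigr => g _ do rewrite mxtrace_Ecomp_tens mulr_sumr.
rewrite exchange_big /=.
rewrite (eq_bigr (fun=> \sum_(k in 'C[x1]%g)
    \tr (U k^-1%g) * (\tr (rho1 k) * ctrace rho2 (k ^ s^-1)))) => [|a _].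
  rewrite sumr_const -[_ *+ #|lreps _|]mulr_natl mulrA; congr (_ * _).
  rewrite cardsT -(card_lreps x1) natrM invfM mulrC mulrA mulfV ?mul1r //.
  apply: contraTneq (cardG_neq0 C [set: gT]) => E.
  by rewrite cardsT -(card_lreps x1) natrM E mul0r eqxx.
(* Conjugating the summation variable by a shows that all coset representatives contribute equally,
   the trace of U being a class function. *)
rewrite (reindex_inj (conjg_inj a^-1%g)) /=.
rewrite (bigID (mem 'C[x1]%g)) /= [X in _ + X]big1 ?addr0 => [|k /andP[_ kC]].
  apply: eq_big => k; first by rewrite in_setT.
  rewrite in_setT /= => kC; rewrite -!conjgM mulKg mulVg conjg1.
  rewrite {1}/ctrace kC; congr (_ * _).
  rewrite -conjVg conjgE !repr_mxM ?in_setT //.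
  by rewrite mxtrace_mulC -mulmxA -repr_mxM ?in_setT // mulgV repr_mx1 mulmx1.
by rewrite -conjgM mulVg conjg1 /ctrace (negPf kC) mul0r mulr0.
Qed.

End TensorOfSimples.

(** * The cyclic torus of SL(2, q) *)

Lemma matrix2P (R : Type) (A B : 'M[R]_2) :
  A 0 0 = B 0 0 -> A 0 1 = B 0 1 -> A 1 0 = B 1 0 -> A 1 1 = B 1 1 -> A = B.
Proof.
move=> E00 E01 E10 E11; apply/matrixP=> i j.
have ord2 (k : 'I_2) : k = 0 \/ k = 1.
  by case: k => [[|[|//]] ?]; [left | right]; apply/val_inj.
by case: (ord2 i) => ->; case: (ord2 j) => ->.
Qed.

Lemma mulmx2E (R : pzSemiRingType) (A B : 'M[R]_2) i j :
  (A *m B) i j = A i 0 * B 0 j + A i 1 * B 1 j.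
Proof. by rewrite mxE big_ord_recl big_ord1; congr (_ + A _ _ * B _ _); apply/val_inj. Qed.

Lemma det_mx22 (R : comNzRingType) (A : 'M[R]_2) :
  \det A = A 0 0 * A 1 1 - A 0 1 * A 1 0.
Proof.
rewrite (expand_det_row _ 0) big_ord_recl big_ord1 /cofactor !det_mx11 !mxE /=.
rewrite expr0 mul1r expr1 mulN1r mulrN.
by congr (A _ _ * A _ _ - A _ _ * A _ _); apply/val_inj.
Qed.

Lemma mx2E (F : finFieldType) (a b c d : F) :
  (mx2 a b c d 0 0 = a) * (mx2 a b c d 0 1 = b) *
  (mx2 a b c d 1 0 = c) * (mx2 a b c d 1 1 = d).
Proof. by rewrite !mxE. Qed.

Lemma det_mx2 (F : finFieldType) (a b c d : F) :
  \det (mx2 a b c d) = a * d - b * c.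
Proof. by rewrite det_mx22 !mx2E. Qed.

(** A matrix is coded by its nonzero first row and one free entry of the second row; the determinant
    equation gives the remaining entry. Which entry is free depends on whether the top left one
    vanishes. *)
Lemma card_SL2 (F : finFieldType) : #|{: SL2 F}| = ((#|F| ^ 2 - 1) * #|F|)%N.
Proof.
pose code (A : SL2 F) := if val A 0 0 != 0
  then ((val A 0 0, val A 0 1), val A 1 0) else ((0, val A 0 1), val A 1 1).
have detA (A : SL2 F) : val A 0 0 * val A 1 1 - val A 0 1 * val A 1 0 = 1.
  by rewrite -det_mx22; apply/eqP/(valP A).
have codeI : injective code.
  move=> A B; have := detA A; have := detA B; rewrite /code.
  have [a0|a0] := eqVneq (val A 0 0) 0; have [b0|b0] := eqVneq (val B 0 0) 0.
  - rewrite a0 b0 !mul0r !sub0r => dB dA [E1 E2]; apply/val_inj/matrix2P => //=.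
      by rewrite a0 b0.
    have nz : val B 0 1 != 0.
      by apply: contraTneq (oner_neq0 F) => z; rewrite -dB z mul0r oppr0 eqxx.
    by apply: (mulfI nz); apply: oppr_inj; rewrite dB -E1 dA.
  - by move=> _ _ [] /esym b1; rewrite b1 eqxx in b0.
  - by move=> _ _ [] a1; rewrite a1 eqxx in a0.
  move=> dB dA [E1 E2 E3]; apply/val_inj/matrix2P => //=.
  by apply: (mulfI a0); apply/eqP; rewrite -(inj_eq (addIr (- (val A 0 1 * val A 1 0))))
    {2}E1 {2}E2 {2}E3 dA dB.
rewrite -(card_codom codeI) (eq_card (B := [predX predC1 (0, 0) & predT])) => [|[[a b] x]].
  by rewrite cardX (cardC1 ((0, 0) : F * F)) card_prod -mulnn subn1.
rewrite !inE andbT /=; apply/codomP/idP => [[A]|ab0].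
  rewrite /code; case: ifP => [a0 [-> -> _]|/negbFE/eqP a0 [-> -> _]].
    by rewrite xpair_eqE negb_and a0.
  rewrite xpair_eqE eqxx /=; apply: contraTneq (oner_neq0 F) => b0.
  by rewrite -(detA A) a0 b0 !mul0r subr0 eqxx.
have [a0|a0] := eqVneq a 0.
  have b0 : b != 0 by apply: contraNneq ab0 => ->; rewrite a0.
  have d1 : \det (mx2 0 b (- b^-1) x) == 1.
    by rewrite det_mx2 mul0r mulrN mulfV // opprK add0r.
  by exists (MkSL2 d1); rewrite /code /= !mx2E eqxx a0.
have d1 : \det (mx2 a b x ((1 + b * x) / a)) == 1.
  by rewrite det_mx2 mulrC divfK // addrK.
by exists (MkSL2 d1); rewrite /code /= !mx2E a0.
Qed.

Lemma sl2_e0 (F : finFieldType) : sl2_e F false = 1%g.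
Proof. by apply/val_inj; rewrite sl2_eE. Qed.

Section Torus.
Variables (F K : finFieldType) (iota : {rmorphism F -> K}) (h : nat).
Variables (ec : {unit K}) (p n : nat).
Hypotheses (p_pr : prime p) (cardFp : #|F| = (p ^ n)%N).
Hypotheses (h_gt0 : (0 < h)%N) (cardF : #|F| = (4 * h + 1)%N).
Hypothesis cardK : #|K| = ((4 * h + 1) ^ 2)%N.
Hypothesis ec_gen : generator [set: {unit K}] ec.

Local Notation y := (val ec).
Local Notation q := (4 * h + 1)%N.
Local Notation et := (gen_et h y).
Local Notation e := (gen_e iota h y).
Local Notation f := (gen_f h y).
Local Notation c := (sl2_c iota h y).

Lemma ec_order : #[ec]%g = (4 * h * (4 * h + 2))%N.
Proof.
rewrite orderE -(eqP ec_gen) card_finField_unit cardK; nia.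
Qed.

Lemma ec_expr_eq1 k : (y ^+ k == 1) = (4 * h * (4 * h + 2) %| k)%N.
Proof. by rewrite -ec_order order_dvdn -FinRing.val_unitX -(inj_eq val_inj). Qed.

Lemma ec_neq0 : y != 0. Proof. by rewrite -unitfE (valP ec). Qed.

Lemma ec_generates (u : K) : u != 0 -> exists k, u = y ^+ k.
Proof.
rewrite -unitfE => uU; have : FinRing.Unit uU \in <[ec]>%g.
  by rewrite -(eqP ec_gen) inE.
by case/cycleP=> k /(congr1 val) /= ->; exists k; rewrite FinRing.val_unitX.
Qed.

Lemma half_gt0 : (0 < 2 * h * (4 * h + 2))%N. Proof. nia. Qed.

Lemma ec_expr_half : y ^+ (2 * h * (4 * h + 2)) = -1.
Proof.
have /eqP : (y ^+ (2 * h * (4 * h + 2))) ^+ 2 = 1.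
  by apply/eqP; rewrite -exprM ec_expr_eq1; apply/dvdnP; exists 1%N; nia.
rewrite sqrf_eq1 ec_expr_eq1 => /orP[|/eqP//].
by by move/(dvdn_leq half_gt0); nia.
Qed.

Lemma two_neq0 : 2 != 0 :> K.
Proof.
apply: contraTneq isT => two0; have : y ^+ (2 * h * (4 * h + 2)) == 1.
  by rewrite ec_expr_half eq_sym -addr_eq0 -mulr2n two0.
by rewrite ec_expr_eq1 => /(dvdn_leq half_gt0); have := half_gt0; clear; nia.
Qed.

Lemma iota_expr_card (x : F) : iota x ^+ q = iota x.
Proof. by rewrite -rmorphXn -cardF expf_card. Qed.

(** The polynomial X^q - X has at most q roots in K, and the image of F already supplies q of
    them. *)
Lemma descendK (u : K) : u ^+ q = u -> iota (descend iota u) = u.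
Proof.
move=> uq; rewrite /descend; case: pickP => [x /eqP//|none] /=.
pose P : {poly K} := 'X^q - 'X.
have sP : size P = q.+1.
  by rewrite /P size_polyDl ?size_polyXn // size_polyN size_polyX; lia.
have P0 : P != 0 by rewrite -size_poly_eq0 sP.
have rootP v : root P v = (v ^+ q == v).
  by rewrite rootE /P hornerD hornerN hornerXn hornerX subr_eq0.
have := max_poly_roots (rs := u :: [seq iota x | x : F]) P0.
rewrite sP /= size_map -cardE cardF ltnn => absurd; suff: false by []. apply: absurd.
  rewrite rootP uq eqxx; apply/allP=> v /mapP[x _ ->].
  by rewrite rootP iota_expr_card.
rewrite (map_inj_uniq (fmorph_inj iota)) enum_uniq andbT.
by apply/mapP=> -[x _ E]; move/negP: (none x); rewrite E.
Qed.

Lemma gen_f_neq0 : f != 0. Proof. by rewrite expf_neq0 // ec_neq0. Qed.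
Lemma gen_et_neq0 : et != 0. Proof. by rewrite expf_neq0 // ec_neq0. Qed.

Lemma gen_f_expr_eq1 k : (f ^+ k == 1) = (4 * h + 2 %| k)%N.
Proof. by rewrite -exprM ec_expr_eq1 dvdn_pmul2l //; lia. Qed.

Lemma gen_f_expr_card : f ^+ q = f^-1.
Proof.
apply: (mulfI gen_f_neq0); rewrite mulfV ?gen_f_neq0 // -exprS.
by apply/eqP; rewrite gen_f_expr_eq1; apply/dvdnP; exists 1%N; lia.
Qed.

Lemma gen_f_expr_half : f ^+ (2 * h + 1) = -1.
Proof. by rewrite -exprM -ec_expr_half; congr (_ ^+ _); nia. Qed.

Lemma gen_et_expr_card : et ^+ q = - et.
Proof.
rewrite -exprM -mulN1r -ec_expr_half -exprD; congr (_ ^+ _); nia.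
Qed.

(** The exponent 4h + 2 is q + 1, so u has norm 1 over F; writing u as a power of the generator of
    order 4h (4h + 2) makes the exponent divisible by 4h. *)
Lemma norm1_gen_f u : u ^+ (4 * h + 2) = 1 -> exists k, u = f ^+ k.
Proof.
move=> u1; have [|k uE] := @ec_generates u.
  by apply: contraTneq (oner_neq0 K) => u0; rewrite -u1 u0 expr0n addnC eqxx.
have /dvdnP[m mE] : (4 * h %| k)%N.
  rewrite -(@dvdn_pmul2r (4 * h + 2)); last by rewrite addn2.
  by rewrite -ec_expr_eq1 exprM -uE u1.
by exists m; rewrite uE mE -exprM mulnC.
Qed.

Lemma iota_gen_e : iota e = et ^+ 2.
Proof.
by apply: descendK; rewrite exprAC gen_et_expr_card sqrrN.
Qed.

Local Notation s1 := ((f + f^-1) / 2).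
Local Notation s1' := ((f - f^-1) / 2).

Lemma expr_cardD (u v : K) : (u + v) ^+ q = u ^+ q + v ^+ q.
Proof.
have pK : p \in [pchar K].
  by rewrite (fmorph_pchar iota) (card_finPcharP cardFp).
by rewrite -cardF cardFp exprDn_pchar // pnatX pnatE ?pK ?orbT.
Qed.

(** The matrices with eigenvector (1, [et])^T, a copy of F[[et]] inside the 2 x 2 matrices;
    [torus_ev] is the eigenvalue. Since [et] ^+ q = - [et], the q-th power gives the conjugate
    eigenvalue. *)
Definition torus (A : 'M[F]_2) := A 1 1 = A 0 0 /\ A 1 0 = e * A 0 1.
Definition torus_ev (A : 'M[F]_2) : K := iota (A 0 0) + iota (A 0 1) * et.

Lemma torus_ev_frob (A : 'M[F]_2) :
  torus_ev A ^+ q = iota (A 0 0) - iota (A 0 1) * et.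
Proof.
by rewrite expr_cardD exprMn !iota_expr_card gen_et_expr_card mulrN.
Qed.

Lemma torus_inj A B : torus A -> torus B -> torus_ev A = torus_ev B -> A = B.
Proof.
move=> [A11 A10] [B11 B10] E; have E' := congr1 (fun u => u ^+ q) E.
rewrite /= !torus_ev_frob in E'; rewrite /torus_ev in E.
have E0 : A 0 0 = B 0 0.
  apply: (fmorph_inj iota); apply: (mulfI two_neq0).
  have sum2 (u v : K) : 2 * u = (u + v) + (u - v) by ring.
  by rewrite (sum2 _ (iota (A 0 1) * et)) E E' -sum2.
have E1 : A 0 1 = B 0 1.
  apply: (fmorph_inj iota); apply: (mulIf gen_et_neq0).
  by apply: (addrI (iota (A 0 0))); rewrite {2}E0.
by apply: matrix2P; rewrite ?A11 ?B11 ?A10 ?B10 ?E0 ?E1.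
Qed.

Lemma torusM A B : torus A -> torus B ->
  torus (A *m B) /\ torus_ev (A *m B) = torus_ev A * torus_ev B.
Proof.
move=> [A11 A10] [B11 B10]; rewrite /torus /torus_ev !mulmx2E A11 B11 A10 B10.
split; first by split; ring.
by rewrite !rmorphD !rmorphM /= iota_gen_e; ring.
Qed.

Lemma torus_scalar a : torus a%:M /\ torus_ev a%:M = iota a.
Proof. by rewrite /torus /torus_ev !mxE /= mulr0 mulr1n mulr0n rmorph0 mul0r addr0. Qed.

Lemma gen_f_frob_add : (f + f^-1) ^+ q = f + f^-1.
Proof. by rewrite expr_cardD exprVn gen_f_expr_card invrK addrC. Qed.

Lemma gen_f_frob_sub : (f - f^-1) ^+ q = - (f - f^-1).
Proof.
rewrite expr_cardD -mulN1r exprMn exprVn gen_f_expr_card invrK.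
have -> : (-1 : K) ^+ q = -1 by rewrite -signr_odd oddD oddM /= expr1.
by ring.
Qed.

Lemma two_frob : (2 : K) ^+ q = 2.
Proof. by rewrite -(rmorph_nat iota) iota_expr_card. Qed.

Lemma sl2_c_entries :
  [/\ iota (descend iota s1) = s1,
      iota (descend iota (s1' * et^-1)) = s1' * et^-1 &
      iota (descend iota (s1' * et)) = s1' * et].
Proof.
split; apply: descendK; rewrite !exprMn ?exprVn ?gen_et_expr_card
  ?gen_f_frob_add ?gen_f_frob_sub two_frob //.
- by rewrite invrN mulrN mulNr mulNr opprK.
- by rewrite mulrN mulNr mulNr opprK.
Qed.

Lemma sl2_cE : val c = mx2 (descend iota s1) (descend iota (s1' * et^-1))
  (descend iota (s1' * et)) (descend iota s1).
Proof.
rewrite val_insubd det_mx2 ifT //; apply/eqP/(fmorph_inj iota).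
have [E1 E2 E3] := sl2_c_entries.
rewrite rmorph1 rmorphB !rmorphM /= E1 E2 E3.
have := gen_f_neq0; have := gen_et_neq0; have := two_neq0.
by move: f et => u v t0 v0 u0; field; rewrite v0 u0 t0.
Qed.

Lemma torus_c : torus (val c) /\ torus_ev (val c) = f.
Proof.
have [E1 E2 E3] := sl2_c_entries; rewrite sl2_cE /torus /torus_ev !mx2E E1 E2.
have et0 := gen_et_neq0; split; last first.
  have := two_neq0; have := gen_f_neq0; move: f et et0 => u v v0 u0 t0.
  by field; rewrite v0 t0 u0.
split=> //; apply: (fmorph_inj iota); rewrite rmorphM /= E2 E3 iota_gen_e.
by move: s1' et et0 => u v v0; field.
Qed.

Lemma torus_cX k : torus (val (c ^+ k)%g) /\ torus_ev (val (c ^+ k)%g) = f ^+ k.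
Proof.
have [tc ec1] := torus_c; elim: k => [|k [IH1 IH2]].
  by have := torus_scalar 1; rewrite rmorph1.
have [tm em] := torusM tc IH1; rewrite expgS exprS.
by split; [exact: tm | rewrite [LHS]em ec1 IH2].
Qed.

Lemma sl2_c_order : #[c]%g = (4 * h + 2)%N.
Proof.
apply/eqP; rewrite eqn_dvd order_dvdn -gen_f_expr_eq1.
have E k : (c ^+ k == 1)%g = (f ^+ k == 1).
  apply/eqP/eqP=> [ck1|fk1].
    have [_ <-] := torus_cX k; rewrite ck1.
    by have [_ ->] := torus_scalar 1; rewrite rmorph1.
  have [tk ek] := torus_cX k; apply/val_inj/(torus_inj tk).
    exact: (torus_scalar 1).1.
  by rewrite ek fk1 (torus_scalar 1).2 rmorph1.
by rewrite E gen_f_expr_eq1 dvdnn /= -E expg_order.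
Qed.

Lemma sl2_c_half : (c ^+ (2 * h + 1))%g = sl2_e F true.
Proof.
have [tk ek] := torus_cX (2 * h + 1); apply/val_inj/(torus_inj tk).
  by rewrite sl2_eE; exact: (torus_scalar _).1.
by rewrite ek sl2_eE (torus_scalar _).2 gen_f_expr_half expr1 rmorphN1.
Qed.

Lemma det_SL2 (A : SL2 F) : val A 0 0 * val A 1 1 - val A 0 1 * val A 1 0 = 1.
Proof. by rewrite -det_mx22; apply/eqP/(valP A). Qed.

(** The determinant of a torus matrix is the norm of its eigenvalue, so determinant 1 makes the
    eigenvalue a power of [f], and the eigenvalue determines the matrix. *)
Lemma torus_sub_c (A : SL2 F) : torus (val A) -> A \in <[c]>%g.
Proof.
move=> tA; have [|k fk] := @norm1_gen_f (torus_ev (val A)).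
  have -> : (4 * h + 2 = q.+1)%N by lia.
  rewrite exprS torus_ev_frob /torus_ev mulrC -subr_sqr exprMn -iota_gen_e.
  have [A11 A10] := tA; have := det_SL2 A; rewrite A11 A10 => /(congr1 iota).
  by rewrite rmorphB !rmorphM /= rmorph1 => <-; ring.
apply/cycleP; exists k; apply/val_inj; apply: torus_inj tA _ _.
  exact: (torus_cX k).1.
by rewrite (torus_cX k).2.
Qed.

Lemma cent1_sl2_c l : (1 <= l <= 2 * h)%N -> 'C[(c ^+ l)%g]%g = <[c]>%g.
Proof.
move=> /andP[l1 l2]; apply/setP=> A; apply/idP/idP; last first.
  by case/cycleP=> k ->; apply/cent1P/commuteX/commute_sym/commuteX/commute_refl.
move/cent1P=> /(congr1 val) /= AB; apply: torus_sub_c.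
have [[B11 B10] evB] := torus_cX l; set B := val (c ^+ l)%g in AB B11 B10 evB.
have b0 : B 0 1 != 0.
  (* A vanishing off-diagonal entry would make c^l scalar with square 1, forcing 4h + 2 to divide
     2l, too small for that. Once this entry is nonzero, the commutation equations put A in torus
     form. *)
  apply/eqP=> b0; have : f ^+ (2 * l) == 1.
    have := det_SL2 (c ^+ l)%g; rewrite -/B B11 b0 mul0r subr0 => /(congr1 iota).
    rewrite rmorphM rmorph1 => E; rewrite mulnC exprM -evB /torus_ev b0.
    by rewrite rmorph0 mul0r addr0 expr2 E.
  by rewrite gen_f_expr_eq1 => /dvdn_leq; lia.
have {}AB : val A *m B = B *m val A by [].
have := congr1 (fun M : 'M_2 => M 0 0) AB.
have := congr1 (fun M : 'M_2 => M 0 1) AB.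
rewrite /= !mulmx2E B11 B10 => E01 E00; split.
- apply: (mulIf b0); apply: (addrI (val A 0 1 * B 0 0)).
  by rewrite [RHS]addrC E01; ring.
- apply: (mulfI b0); apply: (addrI (B 0 0 * val A 0 0)); rewrite -E00; ring.
Qed.

(** Conjugation by diag(j, -j) negates the off-diagonal entries, which inverts a torus matrix of
    determinant 1; it lies in SL(2, q) because j^2 = -1. *)
Lemma sl2_c_inv : exists t, (t * c * t^-1 = c^-1)%g.
Proof.
have [j jE] : exists j : F, j ^+ 2 = -1.
  (* This power squares to -1 and is fixed by the q-Frobenius because q - 1 = 4h, so it descends to
     the required j in F. *)
  have uq : (y ^+ (h * (4 * h + 2))) ^+ q = y ^+ (h * (4 * h + 2)).
    rewrite -exprM -[RHS]mul1r -{1}(expr1n K h).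
    have /eqP <- : y ^+ (4 * h * (4 * h + 2)) == 1 by rewrite ec_expr_eq1.
    by rewrite -exprM -exprD; congr (_ ^+ _); nia.
  exists (descend iota (y ^+ (h * (4 * h + 2)))); apply: (fmorph_inj iota).
  rewrite rmorphXn /= descendK // rmorphN1 -ec_expr_half -exprM.
  by congr (_ ^+ _); nia.
have jd : \det (mx2 j 0 0 (- j)) == 1.
  by rewrite det_mx2 mulr0 subr0 mulrN -expr2 jE opprK.
exists (MkSL2 jd); apply: (mulgI c); rewrite mulgV; apply: (mulIg (MkSL2 jd)).
rewrite mul1g !mulgA mulgKV; apply/val_inj => /=.
have [[c11 c10] _] := torus_c; have := det_SL2 c; move: c11 c10.
set B := val c => B11 B10; rewrite B11 B10 => detB.
apply: matrix2P; rewrite !(mulmx2E, mx2E) ?B11 ?B10.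
- rewrite -[RHS]mulr1 -detB; ring.
- ring.
- ring.
- rewrite -[RHS]mulr1 -detB; ring.
Qed.

End Torus.

(** * Roots of unity and multiplicities *)

Section OrthogonalFamily.
Variables (C : numClosedFieldType) (gT : finGroupType) (G : {group gT}).
Variables (I : eqType) (s : seq I) (U : I -> representation C G) (m : I -> nat).
Hypotheses (s_uniq : uniq s) (irrU : {in s, forall i, mx_irreducible (U i)}).
Hypothesis U_inj : {in s &, forall i j, mx_rsim (U i) (U j) -> i = j}.
Variable B : representation C G.
Hypothesis BE : forall V, rdot V B = \sum_(i <- s) rdot V (U i) *+ m i.

Lemma rdot_orthogonal_sum i : i \in s -> rdot (U i) B = (m i)%:R.
Proof.
move=> si; rewrite BE (bigD1_seq i) //= rdot_irr; last exact: irrU.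
rewrite [X in _ + X]big1_seq ?addr0 //.
move=> j /andP[ji sj]; rewrite rdot_nrsim ?mul0rn; [by []|exact: irrU|exact: irrU|] => ij.
by rewrite (U_inj si sj ij) eqxx in ji.
Qed.

(** Every constituent of B is isomorphic to some U_i, where the pairings of A and B agree; equality
    of degrees then leaves no room for further constituents of A. *)
Lemma rsim_orthogonal_sum (A : representation C G) : rdegree A = rdegree B ->
  {in s, forall i, rdot (U i) A = (m i)%:R} -> mx_rsim A B.
Proof.
move=> dAB AE; apply: rsim_rdot_degree => // V irrV VB.
have [i si Vi] : exists2 i, i \in s & mx_rsim V (U i).
  have [/hasP[i si Vi]|/hasPn none] := boolP (has (fun i => rdot V (U i) != 0) s).
    exists i => //; have [f homf f0] := rdot_neq0_intertwiner Vi.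
    by apply: intertwiner_rsim homf f0 irrV _; apply: irrU.
  case/eqP: VB; rewrite BE big_seq big1 // => i /none/negPn/eqP ->.
  by rewrite mul0rn.
rewrite (rdot_rsim Vi (mx_rsim_refl A)) (rdot_rsim Vi (mx_rsim_refl B)).
by rewrite AE // rdot_orthogonal_sum.
Qed.

End OrthogonalFamily.

Section Zeta.
Local Open Scope complex_scope.
Variable R : realType.

Lemma de_moivre (t : R) k :
  (cos t +i* sin t) ^+ k = cos (t * k%:R) +i* sin (t * k%:R).
Proof.
elim: k => [|k IHk]; first by rewrite mulr0 cos0 sin0.
rewrite exprSr IHk -[k.+1%:R]natr1 mulrDr mulr1 cosD sinD.
by apply/eqP; rewrite eq_complex /= eqxx /= addrC eqxx.
Qed.

(** A smaller order k would give 1 = cos (2 pi k / m) = 1 - 2 sin^2 (pi k / m), while 0 < pi k / m <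
    pi makes the sine positive. *)
Lemma zeta_prim m : (0 < m)%N -> m.-primitive_root (zeta R m).
Proof.
move=> m_gt0; have m0 : m%:R != 0 :> R by rewrite pnatr_eq0 -lt0n.
have zm : zeta R m ^+ m = 1.
  by rewrite de_moivre divfK // mulr_natl cos2pi sin2pi.
have [k pk dvk] := prim_order_exists m_gt0 zm; have k_gt0 := prim_order_gt0 pk.
suff mk : m = k by rewrite {1}mk.
apply/eqP; rewrite eqn_leq (dvdn_leq m_gt0 dvk) andbT leqNgt; apply/negP => km.
have := prim_expr_order pk; rewrite de_moivre => -[cos1 _].
have mp : 0 < m%:R :> R by rewrite ltr0n.
have sgt : 0 < sin (pi / m%:R * k%:R : R).
  apply: sin_gt0_pi; rewrite mulr_gt0 ?divr_gt0 ?pi_gt0 ?ltr0n //=.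
  by rewrite mulrAC ltr_pdivrMr // ltr_pM2l ?pi_gt0 // ltr_nat.
move: cos1; have -> : 2 * pi / m%:R * k%:R = (pi / m%:R * k%:R) *+ 2 :> R.
  by rewrite -!mulrA mulr_natl.
rewrite cos_mulr2n cos2sin2 mulrnBl => /eqP.
rewrite -subr_eq0 [X in X == 0](_ : _ = - (sin (pi / m%:R * k%:R) ^+ 2 *+ 2)).
  by rewrite oppr_eq0 mulrn_eq0 /= sqrf_eq0 gt_eqF.
by rewrite mulr2n; ring.
Qed.

End Zeta.

Section PrimitiveRoot.
Variables (C : fieldType) (m : nat) (z : C).
Hypothesis z_prim : m.-primitive_root z.

Lemma prim_root_neq0 : z != 0.
Proof.
have := prim_order_gt0 z_prim; apply: contraTneq => z0.
have := prim_expr_order z_prim; rewrite z0 expr0n; case: (m) => //= k /eqP.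
by rewrite eq_sym oner_eq0.
Qed.

Lemma prim_exprz_eq1 k : (z ^ k == 1) = (m %| k)%Z.
Proof.
case: k => k; rewrite dvdzE /=; first by rewrite -(prim_order_dvd z_prim).
by rewrite invr_eq1 -(prim_order_dvd z_prim).
Qed.

Lemma prim_exprz_sum (k : int) :
  \sum_(i < m) z ^ (i%:Z * k) = if (m %| k)%Z then m%:R else 0.
Proof.
have E (i : 'I_m) : z ^ (i%:Z * k) = (z ^ k) ^+ i by rewrite mulrC -exprz_exp.
rewrite (eq_bigr _ (fun i _ => E i)) -prim_exprz_eq1; case: eqP => [->|/eqP n1].
  by rewrite (eq_bigr (fun=> 1)) => [|i _]; rewrite ?expr1n ?sumr_const ?card_ord.
apply/eqP; move: n1; rewrite -subr_eq0 => n1; rewrite -(mulrI_eq0 _ (mulfI n1)).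
rewrite -subrX1 subr_eq0; apply/eqP.
by rewrite exprnP exprzAC -exprnP (prim_expr_order z_prim) exp1rz.
Qed.

(** The difference of the two sides, times z^(s + t), factors as (z^s - z^t) (z^(s + t) - 1). The
    bound on s + t makes the second factor vanish only when s = t = 0. *)
Lemma prim_addV_inj s t : (s + t < m)%N ->
  z ^+ s + z ^- s = z ^+ t + z ^- t -> s = t.
Proof.
move=> st E; have [x0 y0] : z ^+ s != 0 /\ z ^+ t != 0.
  by rewrite !expf_neq0 // prim_root_neq0.
have : (z ^+ s - z ^+ t) * (z ^+ s * z ^+ t - 1) == 0.
  apply/eqP; rewrite -[RHS](mulr0 (z ^+ s * z ^+ t)) -(subrr (z ^+ t + z ^- t)) -{1}E.
  by field; rewrite x0 y0.
rewrite mulf_eq0 !subr_eq0 -exprD -(prim_order_dvd z_prim).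
rewrite (eq_prim_root_expr z_prim) !modn_small; try lia.
case/orP=> [/eqP//|]; have [|lt0] := posnP (s + t); first by lia.
by move/(dvdn_leq lt0); lia.
Qed.

End PrimitiveRoot.

Lemma big_cycle (V : nmodType) (gT : finGroupType) (x : gT) (G : gT -> V) :
  \sum_(k in <[x]>%g) G k = \sum_(i < #[x]%g) G (x ^+ i)%g.
Proof.
have inj : {in setT &, injective (fun i : 'I_(#[x]%g) => x ^+ i)%g}.
  move=> i j _ _ /eqP; rewrite eq_expg_mod_order !modn_small // => /eqP ij.
  exact/val_inj.
have -> : <[x]>%g = [set (x ^+ nat_of_ord i)%g | i in [set: 'I_(#[x]%g)]].
  apply/setP=> y; apply/idP/imsetP => [/cyclePmin[i lti ->]|[i _ ->]].
    by exists (Ordinal lti).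
  exact: mem_cycle.
by rewrite big_imset //=; apply: eq_bigl => i; rewrite inE.
Qed.

Lemma signz (C : fieldType) (k : int) :
  (-1 : C) ^ k = if (2 %| k)%Z then 1 else -1.
Proof.
case: k => k; rewrite dvdzE /= dvdn2; first by rewrite -exprnP -signr_odd; case: odd.
by rewrite NegzE -exprnN -signr_odd; case: odd; rewrite /= ?invrN ?invr1.
Qed.

(** * The multiplicity of an irreducible as a sum over the torus *)

Section Multiplicity.
Variables (R : realType) (F K : finFieldType) (iota : {rmorphism F -> K}).
Variables (ec : {unit K}) (p n h : nat).
Hypotheses (p_pr : prime p) (cardFp : #|F| = (p ^ n)%N).
Hypotheses (h_gt0 : (0 < h)%N) (cardF : #|F| = (4 * h + 1)%N).
Hypothesis cardK : #|K| = ((4 * h + 1) ^ 2)%N.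
Hypothesis ec_gen : generator [set: {unit K}] ec.
Local Notation c := (sl2_c iota h (val ec)).
Local Notation m := (4 * h + 1).+1.
Local Notation z := (zeta R m).
Local Notation C := (R[i]).

Variables (mu : bool) (l l2 : nat) (w d : int).
Hypotheses (l_range : (1 <= l <= 2 * h)%N).
Hypothesis l2E : l2 = if mu then (2 * h + 1 - l)%N else l.
Variable rho1 : mx_representation R[i] 'C[(c ^+ l)%g] 1.
Hypothesis rho1_star : wstar iota h (val ec) ((-1) ^+ mu * w + d) rho1.
Variable rho2 : mx_representation R[i] 'C[(c ^+ l2)%g] 1.
Hypothesis rho2_star : wstar iota h (val ec) w rho2.
Let X := Etens (Esimple rho1) (Esimple rho2).
Let Xmu := Ecomp X (sl2_e_central F mu).

Let zP : m.-primitive_root z := zeta_prim R (ltn0Sn _).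
Let z0 : z != 0 := prim_root_neq0 zP.

Let cent1_c k : (1 <= k <= 2 * h)%N -> 'C[(c ^+ k)%g]%g = <[c]>%g.
Proof. by move=> k_range; apply: cent1_sl2_c p_pr cardFp _ _ _ _ _ k_range. Qed.

Let l2_range : (1 <= l2 <= 2 * h)%N.
Proof. by rewrite l2E; case: mu; lia. Qed.

Let c_order : #[c]%g = m.
Proof. by rewrite (sl2_c_order iota p_pr cardFp) // addn2 addn1. Qed.

Let c_half : (c ^+ (2 * h + 1))%g = sl2_e F true.
Proof. by rewrite (sl2_c_half iota p_pr cardFp). Qed.

(** For mu = - take s = 1, since c^(2h + 1) = - e; for mu = + take s inverting c. The second clause
    transports the character of the second factor back to <c>. *)
Lemma conj_pair : exists s, [/\ (s * (c ^+ l) * s^-1 * c ^+ l2)%g = sl2_e F mu &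
  forall i, ((c ^+ i) ^ s^-1 = if mu then c ^+ i else (c ^+ i)^-1)%g].
Proof.
rewrite l2E; case: mu.
  exists 1%g; rewrite mul1g invg1 mulg1; split=> [|i]; last by rewrite conjg1.
  by rewrite -c_half -expgD; congr (_ ^+ _)%g; lia.
have [t tc] := sl2_c_inv iota p_pr cardFp h_gt0 cardF cardK ec_gen.
have tcX i : ((c ^+ i) ^ t^-1 = (c ^+ i)^-1)%g.
  by rewrite conjXg conjgE invgK mulgA tc expgVn.
exists t; split=> //; rewrite sl2_e0.
by have := tcX l; rewrite conjgE invgK mulgA => ->; rewrite mulVg.
Qed.

Lemma rdot_Xmu (U : SL2rep R F) : rdot U Xmu =
  m%:R^-1 * \sum_(i < m) \tr (U (c ^+ i)^-1%g) * z ^ (i%:Z * d).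
Proof.
have [s [sz conj_s]] := conj_pair.
rewrite (rdot_Ecomp_tens _ sz); congr (_ * _).
  by rewrite cent1_c // -orderE c_order.
rewrite (eq_bigl [in <[c]>%g]) => [|k]; last by rewrite cent1_c.
rewrite big_cycle c_order; apply: eq_bigr => i _; congr (_ * _); rewrite conj_s rho1_star /ctrace.
rewrite mxtrace_scalar mulr1n.
have -> : ((if mu then c ^+ i else (c ^+ i)^-1) \in 'C[(c ^+ l2)%g])%g.
  by rewrite cent1_c //; case: mu; rewrite ?groupV mem_cycle.
have ci : (c ^+ i \in 'C[(c ^+ l2)%g])%g by rewrite cent1_c // mem_cycle.
case: mu {conj_s sz}.
  rewrite rho2_star mxtrace_scalar mulr1n -expfzDr // -mulrDr.
  by congr (_ ^ (_ * _)); rewrite expr1; ring.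
rewrite repr_mxV // rho2_star invmx_scalar mxtrace_scalar mulr1n.
rewrite invr_expz -expfzDr // -mulrN -mulrDr.
by congr (_ ^ (_ * _)); rewrite expr0; ring.
Qed.

Lemma degree_Xmu : rdegree Xmu = (4 * h * (4 * h + 1))%N.
Proof.
have [s [sz _]] := conj_pair; rewrite (degree_Ecomp_tens _ sz) !muln1.
have := card_lreps (c ^+ l)%g; rewrite cent1_c // -orderE c_order.
rewrite card_SL2 cardF => E; apply/eqP; rewrite -(eqn_pmul2r (ltn0Sn (4 * h + 1))) E.
by apply/eqP; nia.
Qed.

Let z_half : z ^ (2 * h + 1)%:Z = -1.
Proof.
have : (z ^ (2 * h + 1)%:Z) ^+ 2 == 1.
  by rewrite -exprnP -exprM -(prim_order_dvd zP); apply/dvdnP; exists 1%N; lia.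
rewrite sqrf_eq1 (prim_exprz_eq1 zP) => /orP[|/eqP//].
by rewrite dvdzE /= => /dvdn_leq; lia.
Qed.

(** All rows of the table share this shape on <c>, so one Fourier computation treats them together.
    The N-term is the excess at the two central elements c^0 and c^(2h + 1). *)
Lemma rdot_Xmu_row (U : SL2rep R F) (N S J : nat) (kap : C) :
  (forall b : bool, \tr (U (sl2_e F b)) = ((2 * h + 1) * N)%:R * ((-1) ^+ b) ^+ S
     + kap * 2 * ((-1) ^+ b) ^+ J) ->
  (forall k, (1 <= k <= 2 * h)%N ->
     \tr (U (c ^+ k)%g) = kap * (z ^+ (J * k) + z ^- (J * k))) ->
  rdot U Xmu = (N * (2 %| d + S%:Z)%Z)%:R
    + kap * ((m %| d - J%:Z)%Z%:R + (m %| d + J%:Z)%Z%:R).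
Proof.
move=> Ue Uc.
(* One formula for the trace on all of <c>, symmetric under i |-> m - i. The hypotheses cover i <=
   2h + 1; the other powers follow by inversion. *)
pose phi i : C := ((2 * h + 1) * N * (2 * h + 1 %| i))%:R * (-1) ^+ (S * i)
  + kap * (z ^ (i%:Z * J%:Z) + z ^ (i%:Z * - J%:Z)).
have half_J (s : bool) : z ^ ((2 * h + 1)%:Z * ((-1) ^+ s * J%:Z)) = (-1) ^+ J.
  rewrite -exprz_exp z_half; case: s; last by rewrite mul1r exprnP.
  by rewrite mulN1r -exprz_inv invrN1 exprnP.
have phiE i : (i <= 2 * h + 1)%N -> \tr (U (c ^+ i)%g) = phi i.
  move=> le_i; have [->|i0] := eqVneq i 0.
    rewrite expg0 -sl2_e0 Ue /phi dvdn0 !mul0r !muln0 !expr0z !expr0 !expr1n.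
    by rewrite muln1 !mulr1.
  have [->|ih] := eqVneq i (2 * h + 1).
    rewrite c_half Ue /phi dvdnn muln1; have := half_J true; have := half_J false.
    rewrite mul1r mulN1r => -> ->; rewrite expr1.
    congr (_ * _ + _); last by ring.
    rewrite -[RHS]signr_odd oddM oddD oddM /= andbT.
    by rewrite signr_odd.
  rewrite Uc; last by lia.
  rewrite /phi (_ : (2 * h + 1 %| i)%N = false) ?muln0 ?mul0r ?add0r.
    by rewrite mulrN -[in RHS]invr_expz -PoszM -!exprnP (mulnC J).
  by apply/negP => /dvdn_leq; lia.
have phi_rev i : (i <= m)%N -> phi (m - i)%N = phi i.
  move=> le_i; have zJ (j : int) : z ^ ((m - i)%N%:Z * j) = z ^ (i%:Z * - j).
    rewrite -subzn // mulrBl expfzDr // mulrN.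
    have /eqP -> : z ^ (m%:Z * j) == 1 by rewrite (prim_exprz_eq1 zP) dvdz_mulr.
    by rewrite mul1r.
  rewrite /phi !zJ opprK [_ + z ^ (i%:Z * J%:Z)]addrC; congr (_ * _ + _).
    congr (_ * _)%:R; congr (nat_of_bool _).
    by rewrite dvdn_subr //; apply/dvdnP; exists 2; lia.
  rewrite -signr_odd -[RHS]signr_odd !oddM oddB // /= oddD oddM /=.
  by [].
have phiV i : (i < m)%N -> \tr (U (c ^+ i)^-1%g) = phi i.
  move=> lt_i; have [le_i|gt_i] := leqP i (2 * h + 1).
    have [t tc] := sl2_c_inv iota p_pr cardFp h_gt0 cardF cardK ec_gen.
    have -> : ((c ^+ i)^-1 = (c ^+ i) ^ t^-1)%g.
      by rewrite conjXg conjgE invgK mulgA tc expgVn.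
    rewrite conjgE invgK -phiE // !repr_mxM ?inE //.
    by rewrite mxtrace_mulC -mulmxA -repr_mxM ?inE // mulVg repr_mx1 mulmx1.
  have -> : ((c ^+ i)^-1 = c ^+ (m - i))%g.
    apply: (mulgI (c ^+ i)%g); rewrite mulgV -expgD subnKC; last exact: ltnW.
    by rewrite -c_order expg_order.
  by rewrite phiE ?phi_rev //; lia.
rewrite rdot_Xmu (eq_bigr (fun i : 'I_m =>
   ((2 * h + 1) * N * (2 * h + 1 %| i))%:R * (-1) ^+ (S * i) * z ^ (i%:Z * d)
   + (kap * z ^ (i%:Z * (d + J%:Z)) + kap * z ^ (i%:Z * (d - J%:Z))))) => [|i _].
  rewrite big_split /= big_split /= -!mulr_sumr !(prim_exprz_sum zP).
  have m0 : m%:R != 0 :> C by rewrite pnatr_eq0.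
  rewrite mulrDr; congr (_ + _); last first.
    move: m%:R m0 => M M0.
    by case: (_ %| d + _)%Z; case: (_ %| d - _)%Z => /=; field.
  (* Only i = 0 and i = 2h + 1 survive; as m = 2 (2h + 1), they give N (1 + (-1)^(S + d)) / 2. *)
  have lt_h : (2 * h + 1 < m)%N by lia.
  rewrite (bigD1 ord0) //= (bigD1 (Ordinal lt_h)) //=; last first.
    by rewrite -(inj_eq val_inj) /=; lia.
  rewrite big1 ?addr0 => [|i /andP[i0 ih]]; last first.
    rewrite (_ : (2 * h + 1 %| i)%N = false) ?muln0 ?mul0r //.
    apply/negP => /dvdnP[[|[|k]] ik].
    - by case/eqP: i0; apply/val_inj; rewrite /= ik.
    - by case/eqP: ih; apply/val_inj; rewrite /= ik mul1n.
    - by have := ltn_ord i; rewrite ik; nia.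
  rewrite dvdn0 dvdnn !muln1 muln0 mul0r expr0 expr0z !mulr1 -mulrA -exprz_exp z_half.
  have -> : (-1) ^+ (S * (2 * h + 1)) = (-1 : C) ^ S%:Z.
    by rewrite -exprnP -signr_odd oddM oddD oddM /= andbT signr_odd.
  rewrite -expfzDr ?oppr_eq0 ?oner_eq0 // signz addrC [S%:Z + d]addrC.
  have -> : m%:R = (2 * h + 1)%:R * 2 :> C by rewrite -natrM; congr _%:R; lia.
  have h0 : (2 * h + 1)%:R != 0 :> C by rewrite pnatr_eq0 addn1.
  rewrite !natrM; move: (2 * h + 1)%:R h0 => M M0.
  by case: (_ %| _)%Z => /=; field.
rewrite phiV // /phi mulrDl; congr (_ + _); rewrite -mulrA -!mulrDr mulrDl.
by rewrite -!expfzDr // -!mulrDr ![_ + d]addrC.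
Qed.

End Multiplicity.

(** * The character table *)

Lemma dvdz_small (m : nat) (x : int) : (`|x| <= m)%N ->
  (m %| x)%Z = (x == 0) || (`|x|%N == m).
Proof.
move=> le_x; rewrite dvdzE /= -absz_eq0; have [->|x0] := posnP `|x|%N.
  by rewrite dvdn0.
apply/idP/eqP => [/(dvdn_leq x0) le_m|->]; last exact: dvdnn.
by apply/eqP; rewrite eqn_leq le_x.
Qed.

(* The irreducible representations are labelled by pairs (kind, parameter),   *)
(* the parameter being 0 except for W_s and X_f.                              *)
Definition labels (h : nat) : seq (nat * nat) :=
  [:: (0, 0); (1, 0)]%N ++ ([seq (2, s) | s <- index_iota 1 (2 * h)]%N ++
  ([seq (3, f) | f <- index_iota 1 (2 * h).+1]%N ++
  [:: (4, 0); (5, 0); (6, 0); (7, 0)]%N)).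

Lemma mem_labels h k a : ((k, a) \in labels h) =
  [|| (k \in [:: 0; 1; 4; 5; 6; 7]) && (a == 0),
      (k == 2) && (1 <= a < 2 * h) | (k == 3) && (1 <= a <= 2 * h)]%N.
Proof.
have pairE j (r : seq nat) : ((k, a) \in [seq (j, s) | s <- r]) = (k == j) && (a \in r).
  apply/mapP/andP => [[s rs [-> ->]]|[/eqP-> ra]]; first by [].
  by exists a.
rewrite /labels !mem_cat !pairE !mem_index_iota !inE !xpair_eqE; lia.
Qed.

Lemma labels_uniq h : uniq (labels h).
Proof.
have disj (r s : seq (nat * nat)) (k : seq nat) : {in r, forall i, i.1 \in k} ->
    {in s, forall i, i.1 \notin k} -> ~~ has (mem r) s.
  move=> rk sk; apply/hasPn => i si; apply/negP => /rk ik.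
  by have := sk i si; rewrite ik.
rewrite /labels !cat_uniq !map_inj_uniq => [|i j []|i j []] //.
rewrite !iota_uniq /= !andbT; apply/and3P; split.
- apply: (disj _ _ [:: 0; 1]%N) => -[k a]; first by rewrite !inE !xpair_eqE /=; lia.
  rewrite !mem_cat => /or3P[/mapP[s _ [-> _]]|/mapP[s _ [-> _]]|] //.
  by rewrite !inE !xpair_eqE /=; lia.
- apply: (disj _ _ [:: 2]%N) => -[k a]; first by case/mapP=> s _ [-> _].
  rewrite mem_cat => /orP[/mapP[s _ [-> _]]|] //.
  by rewrite !inE !xpair_eqE /=; lia.
- apply: (disj _ [:: (4, 0); (5, 0); (6, 0); (7, 0)] [:: 3])%N => -[k a]; first by case/mapP=> s _ [-> _].
  by rewrite !inE !xpair_eqE /=; lia.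
Qed.

Section Labels.
Variables (R : realType) (F : finFieldType).

Definition irr_of (T : SL2_irreps R F) (i : nat * nat) : SL2rep R F :=
  match i.1 with
  | 0 => irr1 T | 1 => irrV T | 2 => irrW T i.2 | 3 => irrX T i.2
  | 4 => irrW' T | 5 => irrW'' T | 6 => irrX' T | _ => irrX'' T
  end%N.

Definition mult_of (M : mults) (i : nat * nat) : nat :=
  match i.1 with
  | 0 => n0 M | 1 => m0 M | 2 => n_ M i.2 | 3 => m_ M i.2
  | 4 => n' M | 5 => n'' M | 6 => m' M | _ => m'' M
  end%N.

(** Applied both to the pairing with a fixed representation and to the degree. *)
Lemma irr_sum_morph (V : nmodType) (phi : SL2rep R F -> V) h T M :
  phi grepr0 = 0 ->
  (forall A B, phi (dadd_grepr A B) = phi A + phi B) ->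
  phi (irr_sum h T M) = \sum_(i <- labels h) phi (irr_of T i) *+ mult_of M i.
Proof.
move=> phi0 phiD.
have phiX A k : phi (muln_grepr A k) = phi A *+ k.
  by rewrite /muln_grepr (big_morph phi phiD phi0) sumr_const card_ord.
rewrite /irr_sum !phiD !phiX !(big_morph phi phiD phi0).
under eq_bigr do rewrite phiX.
under [X in _ + (_ + (_ + (X + _)))]eq_bigr do rewrite phiX.
rewrite /labels !big_cat !big_map !big_cons big_nil /= /irr_of /mult_of /=.
by rewrite !addr0 -?addrA.
Qed.

(* For z = exp(2 pi i / (q + 1)), the character labelled i takes at c^t the   *)
(* value (2h + 1) N [2h + 1 | t] (-1)^(S t) + kap (z^(J t) + z^(- J t)), which *)
(* at c^0 and c^(2h + 1) gives its values at the central elements.            *)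
Definition row_N (i : nat * nat) : nat := nth 0%N [:: 0; 2; 2; 2; 1; 1; 1; 1]%N i.1.
Definition row_S (i : nat * nat) : nat := match i.1 with
  | 2 | 3 => i.2 | 6 | 7 => 1 | _ => 0 end%N.
Definition row_J (h : nat) (i : nat * nat) : nat := match i.1 with
  | 3 => i.2 | 6 | 7 => 2 * h + 1 | _ => 0 end%N.
(** The halves occur for J = 0 and J = 2h + 1, where z^(J t) and z^(- J t) coincide. *)
Definition row_kap (i : nat * nat) : R[i] := match i.1 with
  | 0%N => 2^-1 | 1%N => - 2^-1 | 3%N => -1 | 6%N | 7%N => - 2^-1 | _ => 0 end.
Definition row_deg (h : nat) (i : nat * nat) : nat :=
  nth 0%N [:: 1; 4 * h + 1; 4 * h + 2; 4 * h; 2 * h + 1; 2 * h + 1; 2 * h; 2 * h]%N i.1.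

Variables (K : finFieldType) (iota : {rmorphism F -> K}) (h : nat) (ec : K).
Hypothesis h_gt0 : (0 < h)%N.
Variable T : SL2_irreps R F.
Hypothesis T_table : char_table iota h ec T.
Local Notation c := (sl2_c iota h ec).
Local Notation m := (4 * h + 1).+1.
Local Notation z := (zeta R m).

Let zP : m.-primitive_root z := zeta_prim R (ltn0Sn _).

Let z_half k : z ^+ ((2 * h + 1) * k) = (-1) ^+ k.
Proof.
rewrite exprM; congr (_ ^+ _).
have /eqP : (z ^+ (2 * h + 1)) ^+ 2 = 1.
  by apply/eqP; rewrite -exprM -(prim_order_dvd zP); apply/dvdnP; exists 1%N; lia.
rewrite sqrf_eq1 -(prim_order_dvd zP) => /orP[|/eqP//].
by move/dvdn_leq; lia.
Qed.

Lemma table_irr i : i \in labels h -> mx_irreducible (irr_of T i).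
Proof.
move: T_table => [t1 [tV [tW [tX [tW' [tW'' [tX' tX'']]]]]]].
case: i => k a; rewrite mem_labels !inE /irr_of /=.
case: k => [|[|[|[|[|[|[|[|k]]]]]]]] //= ha;
  [case: t1 | case: tV | case: (tW a) | case: (tX a) | case: tW' | case: tW'' |
   case: tX' | case: tX''] => //; lia.
Qed.

Lemma table_e i : i \in labels h -> forall b : bool,
  \tr (irr_of T i (sl2_e F b)) = ((2 * h + 1) * row_N i)%:R * ((-1) ^+ b) ^+ row_S i
    + row_kap i * 2 * ((-1) ^+ b) ^+ row_J h i.
Proof.
move: T_table => [[_ [t1 _ _ _]] [[_ [tV _ _ _]] [tW [tX [[_ [tW' _ _ _]] [[_ [tW'' _ _ _]]
  [[_ [tX' _ _ _]] [_ [tX'' _ _ _]]]]]]]]].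
case: i => k a; rewrite mem_labels !inE /irr_of /row_N /row_S /row_J /row_kap /=.
have two0 : 2 != 0 :> R[i] by rewrite pnatr_eq0.
have sgnJ (b : bool) : ((-1 : R[i]) ^+ b) ^+ (2 * h + 1) = (-1) ^+ b.
  by rewrite exprD exprM sqrr_sign expr1n mul1r.
case: k => [|[|[|[|[|[|[|[|k]]]]]]]] //= ha b.
- by rewrite t1 muln0 mul0r add0r mulVf // mul1r.
- by rewrite tV !expr0 !mulr1 mulNr mulVf // -(@natrB _ _ 1); [congr _%:R|]; lia.
- have [|_ [-> _ _ _]] := tW a; try lia.
  by rewrite !mul0r addr0; congr (_%:R * _); lia.
- have [|_ [-> _ _ _]] := tX a; try lia.
  rewrite -mulrDl mulN1r; congr (_ * _); rewrite -natrB; first congr _%:R; lia.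
- by rewrite tW' !mul0r addr0 expr0 mulr1 muln1.
- by rewrite tW'' !mul0r addr0 expr0 mulr1 muln1.
- rewrite tX' sgnJ expr1 mulNr mulVf // -mulrDl; congr (_ * _).
  by rewrite muln1 natrD addrK.
rewrite tX'' sgnJ expr1 mulNr mulVf // -mulrDl; congr (_ * _).
by rewrite muln1 natrD addrK.
Qed.

Lemma table_c i : i \in labels h -> forall t, (1 <= t <= 2 * h)%N ->
  \tr (irr_of T i (c ^+ t)%g) =
  row_kap i * (z ^+ (row_J h i * t) + z ^- (row_J h i * t)).
Proof.
move: T_table => [[_ [_ _ _ t1]] [[_ [_ _ _ tV]] [tW [tX [[_ [_ _ _ tW']] [[_ [_ _ _ tW'']]
  [[_ [_ _ _ tX']] [_ [_ _ _ tX'']]]]]]]]].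
case: i => k a; rewrite mem_labels !inE /irr_of /row_J /row_kap /=.
have two0 : 2 != 0 :> R[i] by rewrite pnatr_eq0.
case: k => [|[|[|[|[|[|[|[|k]]]]]]]] //= ha t t_range.
- by rewrite t1 // mul0n invr1 mulVf.
- by rewrite tV // mul0n invr1 mulNr mulVf.
- by have [|_ [_ _ _ ->]] := tW a; rewrite ?mul0r //; lia.
- by have [|_ [_ _ _ ->]] := tX a; rewrite ?mulN1r ?opprD //; lia.
- by rewrite tW' // mul0r.
- by rewrite tW'' // mul0r.
- by rewrite tX' // z_half exprS invr_sign; field.
by rewrite tX'' // z_half exprS invr_sign; field.
Qed.

Lemma table_degree i : i \in labels h -> rdegree (irr_of T i) = row_deg h i.
Proof.
move=> ih; have := table_e ih false; rewrite sl2_e0 repr_mx1 mxtrace1 !expr1n !mulr1.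
case: i ih => k a; rewrite mem_labels !inE /row_N /row_kap /row_deg /=.
have two0 : 2 != 0 :> R[i] by rewrite pnatr_eq0.
move=> ih E; apply/eqP; rewrite -(eqr_nat R[i]) {}E; move: ih.
case: k => [|[|[|[|[|[|[|[|k]]]]]]]] //= _.
- by rewrite muln0 add0r mulVf.
- by rewrite mulNr mulVf // -(@natrB _ _ 1) ?eqr_nat; lia.
- by rewrite mul0r addr0 eqr_nat; lia.
- by rewrite mulN1r -natrB ?eqr_nat; lia.
- by rewrite mul0r addr0 eqr_nat; lia.
- by rewrite mul0r addr0 eqr_nat; lia.
- by rewrite mulNr mulVf // -(@natrB _ _ 1) ?eqr_nat; lia.
by rewrite mulNr mulVf // -(@natrB _ _ 1) ?eqr_nat; lia.
Qed.

Lemma s_pm_inj : s_pm R h false != s_pm R h true.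
Proof.
have s0 : (Num.sqrt (4 * h + 1)%:R : R) != 0.
  by rewrite gt_eqF // sqrtr_gt0 ltr0n addn1.
apply/eqP=> /(congr1 (fun x => complex.Re (x * 2))).
rewrite /s_pm !divfK ?pnatr_eq0 //= oppr0 !mul0r !subr0 mul1r mulN1r.
move/addrI/eqP; rewrite -subr_eq0 opprK -mulr2n mulrn_eq0 /=.
by rewrite (negPf s0).
Qed.

(** Degrees separate the kinds except W' from W'' and X' from X'', which differ at b_+ because
    [s_pm] does. Within the families, the values at a and at c recover the parameter: two parameters
    sum to less than q - 1 for W, and to less than q + 1 for X. *)
Lemma table_inj : {in labels h &, forall i j, mx_rsim (irr_of T i) (irr_of T j) -> i = j}.
Proof.
move=> i j ih jh ij; have := mxrank_rsim ij; rewrite !table_degree //.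
have trE g : \tr (irr_of T i g) = \tr (irr_of T j g).
  by apply: (mxtrace_rsim ij); rewrite inE.
move: T_table => [_ [_ [tW [tX [[_ [_ _ tW' _]] [[_ [_ _ tW'' _]]
  [[_ [_ _ tX' _]] [_ [_ _ tX'' _]]]]]]]]].
have bE := trE (sl2_e F false * sl2_b iota h ec false)%g.
case: i j {ij} ih jh trE bE => [k a] [k' a']; rewrite !mem_labels !inE.
rewrite /row_deg /irr_of /=.
case: k => [|[|[|[|[|[|[|[|k]]]]]]]] //= ha;
case: k' => [|[|[|[|[|[|[|[|k']]]]]]]] //= hb trE bE dE; try by exfalso; lia.
all: try by congr (_, _); lia.
- congr (_, _); have [|_ [_ Ea _ _]] := tW a; try lia.
  have [|_ [_ Eb _ _]] := tW a'; try lia.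
  have := trE (sl2_a iota h ec ^+ 1)%g; rewrite Ea ?Eb; try lia.
  rewrite !muln1; apply: (prim_addV_inj (zeta_prim R _)); lia.
- congr (_, _); have [|_ [_ _ _ Ea]] := tX a; try lia.
  have [|_ [_ _ _ Eb]] := tX a'; try lia.
  have := trE (c ^+ 1)%g; rewrite Ea ?Eb; try lia.
  rewrite !muln1 -!opprD => /oppr_inj; apply: (prim_addV_inj zP); lia.
- by case/eqP: s_pm_inj; rewrite tW' tW'' in bE.
- by case/eqP: s_pm_inj; rewrite tW' tW'' in bE.
- by case/eqP: s_pm_inj; move: bE; rewrite tX' tX'' expr0 !mulN1r => /oppr_inj.
- by case/eqP: s_pm_inj; move: bE; rewrite tX' tX'' expr0 !mulN1r => /oppr_inj.
Qed.

End Labels.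

(** * The expected multiplicities and the theorem *)

Definition expected (h : nat) (d : int) : mults := {|
  n0 := d == 0;
  m0 := if (2 %| d)%Z then (2 - (d == 0)%R)%N else 0%N;
  n_ s := (2 * (2 %| (d + s%:Z)%R)%Z)%N;
  m_ f := (2 * (2 %| (d + f%:Z)%R)%Z - (`|d| == f))%N;
  n' := (2 %| d)%Z;
  n'' := (2 %| d)%Z;
  m' := ~~ (2 %| d)%Z && (`|d| != 2 * h + 1)%N;
  m'' := ~~ (2 %| d)%Z && (`|d| != 2 * h + 1)%N
|}.

(** The parity of d + s treats even and odd d uniformly. The truncated subtraction in [m_] is exact,
    since |d| = f makes d + f even. *)
Lemma row_expected (R : realType) (h : nat) (d : int) (i : nat * nat) :
  (0 < h)%N -> (`|d| <= 2 * h + 1)%N -> i \in labels h ->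
  (row_N i * (2 %| d + (row_S i)%:Z)%Z)%:R + row_kap R i *
    (((4 * h + 1).+1 %| d - (row_J h i)%:Z)%Z%:R +
     ((4 * h + 1).+1 %| d + (row_J h i)%:Z)%Z%:R)
  = (mult_of (expected h d) i)%:R.
Proof.
move=> h_gt0 d_le.
have two0 : 2 != 0 :> R[i] by rewrite pnatr_eq0.
case: i => k a; rewrite mem_labels !inE /row_N /row_S /row_J /row_kap /mult_of /=.
(* Both d - J and d + J have absolute value at most m, so divisibility means 0 or +-m. At J = 0 and
   J = 2h + 1 the two conditions coincide, and the resulting 2 cancels the half in [row_kap]. *)
have JE (J : nat) : (J <= 2 * h + 1)%N ->
   ((((4 * h + 1).+1 %| (d - J%:Z)%R)%Z + ((4 * h + 1).+1 %| (d + J%:Z)%R)%Z) =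
    (if (J == 0) || (J == 2 * h + 1) then 2 * (`|d| == J) else (`|d| == J)))%N.
  by move=> J_le; rewrite !dvdz_small; [case: ifP; lia|lia..].
case: k => [|[|[|[|[|[|[|[|k]]]]]]]] //= ha.
- rewrite mul0n add0r -natrD JE //= absz_eq0.
  by rewrite natrM mulrA mulVf // mul1r.
- rewrite -natrD JE //= absz_eq0 [(2 * (d == 0))%:R]natrM mulNr mulrA mulVf // mul1r addr0.
  have [->|d0] := eqVneq d 0; first by rewrite dvdz0 /= -natrB.
  by rewrite subr0; case: ifP => _; rewrite ?muln1 ?muln0.
- by rewrite mul0r addr0.
- rewrite -natrD JE; last by lia.
  rewrite ifF; last by lia.
  rewrite mulN1r -natrB //; lia.
- by rewrite mul0r !addr0 mul1n.
- by rewrite mul0r !addr0 mul1n.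
- rewrite -natrD JE; last by lia.
  rewrite eqxx orbT mul1n natrM mulNr mulrA mulVf // mul1r -natrB; last by lia.
  by congr _%:R; lia.
rewrite -natrD JE; last by lia.
rewrite eqxx orbT mul1n natrM mulNr mulrA mulVf // mul1r -natrB; last by lia.
by congr _%:R; lia.
Qed.

Lemma degree_expected (h : nat) (d : int) : (0 < h)%N -> (`|d| <= 2 * h + 1)%N ->
  (\sum_(i <- labels h) row_deg h i * mult_of (expected h d) i = 4 * h * (4 * h + 1))%N.
Proof.
move=> h_gt0 d_le.
have even_sum k : (\sum_(1 <= f < (2 * k).+1) (2 %| (d + f%:Z)%R)%Z = k)%N.
  elim: k => [|k IHk]; first by rewrite big_geq.
  have -> : (2 * k.+1).+1 = (2 * k).+3 by lia.
  rewrite big_nat_recr //= big_nat_recr //= IHk; lia.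
have eq_sum k : (\sum_(1 <= f < k.+1) (`|d|%N == f) = (0 < `|d| <= k))%N.
  elim: k => [|k IHk]; first by rewrite big_geq; lia.
  by rewrite big_nat_recr //= IHk; lia.
(* The W_s stop at 2h - 1; the missing term s = 2h would count exactly when d is even. *)
have odd_sum : (\sum_(1 <= s < 2 * h) (2 %| (d + s%:Z)%R)%Z + (2 %| d)%Z = h)%N.
  have := even_sum h; rewrite big_nat_recr /=; lia.
have f_sum : (\sum_(1 <= f < (2 * h).+1) (2 * (2 %| (d + f%:Z)%R)%Z - (`|d| == f)) +
    (0 < `|d| <= 2 * h) = 2 * h)%N.
  rewrite -eq_sum -big_split /= -[in RHS](even_sum h) big_distrr /=.
  by apply: eq_bigr => f _; lia.
rewrite /labels !big_cat !big_map !big_cons !big_nil /row_deg /mult_of /=.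
rewrite -!big_distrr /=.
have := odd_sum; have := f_sum; move: (\sum_(1 <= f < _) _)%N (\sum_(1 <= f < _) _)%N.
by case: (boolP (2 %| d)%Z) => d2 A B; nia.
Qed.

Theorem mainTheorem10 (R : realType) (p n q h : nat)
  (p_prime : prime p) (p_odd : odd p) (q_pow : q = (p ^ n)%N)
  (q_ge5 : (5 <= q)%N) (q_h : q = (4 * h + 1)%N)
  (F K : finFieldType) (cardF : #|F| = q) (cardK : #|K| = (q ^ 2)%N)
  (iota : {rmorphism F -> K})
  (ec : {unit K}) (ec_gen : generator [set: {unit K}] ec)
  (T : SL2_irreps R F) (T_table : char_table iota h (val ec) T)
  (mu : bool) (l : nat) (l_range : (1 <= l <= 2 * h)%N) (w d : int)
  (d_range : (`|d| <= 2 * h + 1)%N)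
  (c := sl2_c iota h (val ec))
  (l_mu := if mu then (2 * h + 1 - l)%N else l)
  (rho1 : mx_representation R[i] 'C[(c ^+ l)%g] 1)
  (rho1_star : wstar iota h (val ec) ((-1) ^+ mu * w + d) rho1)
  (rho2 : mx_representation R[i] 'C[(c ^+ l_mu)%g] 1)
  (rho2_star : wstar iota h (val ec) w rho2)
  (X := Etens (Esimple rho1) (Esimple rho2))
  (Xmu := Ecomp X (sl2_e_central F mu)) :
  (exists M : mults, mx_rsim Xmu (irr_sum h T M)) /\
  (forall M : mults, mx_rsim Xmu (irr_sum h T M) ->
    ((2 %| d)%Z ->
      n' M = 1%N /\ n'' M = 1%N /\
      (n0 M)%:Z = delta (d == 0) /\
      (forall s : nat, (1 <= s <= 2 * h - 1)%N ->
        (n_ M s)%:Z = 2 * delta (2 %| s)%N) /\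
      m' M = 0%N /\ m'' M = 0%N /\
      (m0 M)%:Z = 2 - delta (d == 0) /\
      (forall f : nat, (1 <= f <= 2 * h)%N ->
        (m_ M f)%:Z = 2 * delta (2 %| f)%N - delta (`|d|%N == f))) /\
    (~~ (2 %| d)%Z ->
      n0 M = 0%N /\
      n' M = 0%N /\ n'' M = 0%N /\
      (forall s : nat, (1 <= s <= 2 * h - 1)%N ->
        (n_ M s)%:Z = 2 * delta (~~ (2 %| s)%N)) /\
      m0 M = 0%N /\
      (m' M)%:Z = 1 - delta (`|d|%N == 2 * h + 1)%N /\
      (m'' M)%:Z = 1 - delta (`|d|%N == 2 * h + 1)%N /\
      (forall f : nat, (1 <= f <= 2 * h)%N ->
        (m_ M f)%:Z = 2 * delta (~~ (2 %| f)%N) - delta (`|d|%N == f)))).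
Proof.
have h_gt0 : (0 < h)%N by lia.
have cardFp : #|F| = (p ^ n)%N by rewrite cardF q_pow.
rewrite q_h in cardF cardK.
have XmuE i : i \in labels h -> rdot (irr_of T i) Xmu = (mult_of (expected h d) i)%:R.
  move=> ih; rewrite -(row_expected R h_gt0 d_range ih).
  exact: (rdot_Xmu_row p_prime cardFp h_gt0 cardF cardK ec_gen l_range erefl
    rho1_star rho2_star (table_e h_gt0 T_table ih) (table_c h_gt0 T_table ih)).
have sumE M V : rdot V (irr_sum h T M) =
    \sum_(i <- labels h) rdot V (irr_of T i) *+ mult_of M i.
  exact: (irr_sum_morph (phi := rdot V) h T M (rdot0r V) (rdotDr V)).
have irrT : {in labels h, forall i, mx_irreducible (irr_of T i)}.
  by move=> i; apply: (table_irr h_gt0 T_table).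
have injT := table_inj h_gt0 T_table.
split=> [|M XmuM].
  exists (expected h d); apply: (rsim_orthogonal_sum (labels_uniq h) irrT injT (sumE _)) => //.
  rewrite (degree_Xmu p_prime cardFp h_gt0 cardF cardK ec_gen l_range erefl).
  rewrite -(degree_expected h_gt0 d_range) (irr_sum_morph (phi := @rdegree _ _ _)) //.
  rewrite big_seq [RHS]big_seq; apply: eq_bigr => i ih.
  by rewrite (table_degree h_gt0 T_table ih) -mulr_natr natn.
(* Pairing an arbitrary decomposition with a listed irreducible returns its multiplicity, already
   computed from the component itself. *)
have ME i : i \in labels h -> mult_of M i = mult_of (expected h d) i.
  move=> ih; apply/eqP; rewrite -(eqr_nat R[i]) -XmuE //.
  rewrite (rdot_rsim (mx_rsim_refl _) XmuM).
  by rewrite (rdot_orthogonal_sum (labels_uniq h) irrT injT (sumE _)).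
have label k : k \in [:: 0; 1; 4; 5; 6; 7]%N -> mult_of M (k, 0%N) = mult_of (expected h d) (k, 0%N).
  by move=> kr; apply: ME; rewrite mem_labels kr.
have /= M0 := label 0 isT; have /= M1 := label 1 isT.
have /= M4 := label 4 isT; have /= M5 := label 5 isT.
have /= M6 := label 6 isT; have /= M7 := label 7 isT.
have M2 s : (1 <= s <= 2 * h - 1)%N -> n_ M s = (2 * (2 %| (d + s%:Z)%R)%Z)%N.
  by move=> sr; apply: (ME (2, s)); rewrite mem_labels; lia.
have M3 f : (1 <= f <= 2 * h)%N -> m_ M f = (2 * (2 %| (d + f%:Z)%R)%Z - (`|d| == f))%N.
  by move=> fr; apply: (ME (3, f)); rewrite mem_labels; lia.
rewrite /mult_of /= in M0 M1 M4 M5 M6 M7; rewrite /delta.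
split=> d2; [rewrite d2 in M1 | rewrite (negPf d2) in M1].
  by repeat split; try (move=> f fr; rewrite ?M2 ?M3 //); lia.
by repeat split; try (move=> f fr; rewrite ?M2 ?M3 //); lia.
Qed.
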